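(* \textsc{3SAT} is polynomial-time reducible to \textsc{MaxQueryDec}. Here \textsc{MaxQueryDec} is the following problem. Input: a positive integer $K$; an antimonotonic family $\mathcal{F} = \{B_1,\ldots,B_N\}$ of itemsets over the attributes $A=\{a_1,\ldots,a_K\}$, listed explicitly; a vector $\theta = (\theta_1,\ldots,\theta_N)$ of rational numbers that is consistent for $\mathcal{F}$; an itemset $B \subseteq A$; and a rational threshold $b$. Question: is there a probability distribution $q$ on $\Omega=\{0,1\}^K$ with $q(B_i = 1) = \theta_i$ for all $i$ such that $q(B=1) > b$?
   Context: Let $\Omega = \{0,1\}^K$; the $i$-th coordinate is attribute $a_i$, and $A=\{a_1,\ldots,a_K\}$. An itemset is a subset of $A$. A family of itemsets is antimonotonic if every subset of every member also belongs to it. For a distribution $p$ on $\Omega$ and an itemset $B=\{a_{i_1},\ldots,a_{i_L}\}$, $p(B=1)$ denotes $p(a_{i_1}=1,\ldots,a_{i_L}=1)$, the frequency of $B$. A distribution $p$ satisfies frequencies $\theta$ for a family $\{B_1,\ldots,B_N\}$ if $p(B_i=1)=\theta_i$ for all $i$; $\theta$ is consistent if some distribution satisfies it. \textsc{3SAT} is the satisfiability problem for CNF formulas in which every clause has (at most) three literals. *)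

(* Defs.v *)
From Corelib Require Import BinNums.
From mathcomp Require Import all_boot all_order all_algebra.
From mathcomp Require Import reals.

Set Implicit Arguments.
Unset Strict Implicit.
Unset Printing Implicit Defensive.

Import Order.TTheory GRing.Theory Num.Theory.

Definition symbol : finType := (bool + bool)%type.
Definition Bit (b : bool) : symbol := inl b.
Definition Open : symbol := inr false.
Definition Close : symbol := inr true.
Definition word := seq symbol.

Definition enc_bool (b : bool) : word := [:: Bit b].

Definition enc_seq (T : Type) (e : T -> word) (s : seq T) : word :=
  Open :: flatten (map e s) ++ [:: Close].

(* Least significant bit first. *)
Fixpoint binary_pos (p : positive) : seq bool :=
  match p with
  | xH => [:: true]
  | xO q => false :: binary_pos q
  | xI q => true :: binary_pos q
  end.

Definition binary (n : nat) : seq bool :=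
  if bin_of_nat n is Npos p then binary_pos p else [::].

Definition enc_nat (n : nat) : word := enc_seq enc_bool (binary n).

Definition enc_int (z : int) : word := enc_bool (z < 0)%R ++ enc_nat `|z|%N.

Definition enc_rat (r : rat) : word := enc_int (numq r) ++ enc_int (denq r).

(* The characteristic vector, of length K. *)
Definition enc_set (K : nat) (B : {set 'I_K}) : word :=
  enc_seq enc_bool [seq i \in B | i <- enum 'I_K].

Definition self_delimiting (T : Type) (e : T -> word) :=
  forall x y s t, e x ++ s = e y ++ t -> x = y /\ s = t.

Definition no_leading_close (T : Type) (e : T -> word) :=
  forall x, exists2 a, a <> Close & exists u, e x = a :: u.

Lemma self_delimiting_inj T (e : T -> word) : self_delimiting e -> injective e.
Proof.
move=> he x y exy; have [] // := he x y [::] [::].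
by rewrite exy.
Qed.

Lemma enc_bool_sd : self_delimiting enc_bool.
Proof. by move=> x y s t [-> ->]. Qed.

Lemma enc_bool_nc : no_leading_close enc_bool.
Proof. by move=> x; exists (Bit x) => //; exists [::]. Qed.

Lemma enc_seq_nc T (e : T -> word) : no_leading_close (enc_seq e).
Proof. by move=> x; exists Open => //; eexists. Qed.

Lemma enc_seq_sd T (e : T -> word) :
  self_delimiting e -> no_leading_close e -> self_delimiting (enc_seq e).
Proof.
move=> he hc xs ys s t; rewrite /enc_seq !cat_cons -!catA => -[].
elim: xs ys => [|x xs IH] [|y ys] /=.
- by move=> [].
- by have [a na [u ->]] := hc y => -[] /esym /na.
- by have [a na [u ->]] := hc x => -[] /na.
- by rewrite -!catA => /he [-> /IH [-> ->]].
Qed.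

Lemma binary_pos_inj : injective binary_pos.
Proof.
have nz p : binary_pos p <> [::] by case: p.
elim=> [p IH|p IH|] [q|q|] //= [] => [/IH -> //|/nz //|/IH -> //|/esym /nz //].
Qed.

Lemma binary_inj : injective binary.
Proof.
apply: (@inj_comp _ _ _ (fun m => if m is Npos p then binary_pos p else [::])
          bin_of_nat); last exact: can_inj bin_of_natK.
move=> [|p] [|q] //=; first by case: q.
- by case: p.
- by move=> /binary_pos_inj ->.
Qed.

Lemma enc_nat_sd : self_delimiting enc_nat.
Proof.
move=> x y s t; rewrite /enc_nat.
by move=> /(enc_seq_sd enc_bool_sd enc_bool_nc) [/binary_inj].
Qed.

Lemma enc_int_sd : self_delimiting enc_int.
Proof.
move=> x y s t; rewrite /enc_int -!catA => /enc_bool_sd [sgE].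
move=> /enc_nat_sd [absE ->].
by split=> //; case: x y sgE absE => m [] n //= _; [move-> | case=> ->].
Qed.

Lemma enc_rat_sd : self_delimiting enc_rat.
Proof.
move=> x y s t; rewrite /enc_rat -!catA.
move=> /enc_int_sd [nE /enc_int_sd [dE ->]]; split=> //.
by rewrite -(divq_num_den x) -(divq_num_den y) nE dE.
Qed.

Lemma enc_rat_nc : no_leading_close enc_rat.
Proof. by move=> x; eexists; last by eexists. Qed.

Lemma enc_set_sd K : self_delimiting (@enc_set K).
Proof.
move=> x y s t; rewrite /enc_set.
move=> /(enc_seq_sd enc_bool_sd enc_bool_nc) [/eq_in_map xy ->]; split=> //.
by apply/setP => i; rewrite xy // mem_enum.
Qed.

Lemma enc_set_nc K : no_leading_close (@enc_set K).
Proof. by move=> x; exact: enc_seq_nc. Qed.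

Inductive move := MoveLeft | Stay | MoveRight.

(* None is the blank; a machine may use auxiliary tape symbols from X in
   addition to the input/output alphabet. *)
Definition cell (X : finType) : finType := option (symbol + X)%type.

(* A two-way infinite tape: the cells to the left of the head, nearest first,
   then the scanned cell and the cells to its right. Cells beyond either list
   are blank. *)
Record tape (X : finType) := Tape {
  to_left : seq (cell X);
  from_head : seq (cell X)
}.

Definition read (X : finType) (t : tape X) : cell X := head None (from_head t).

Definition write (X : finType) (a : cell X) (t : tape X) : tape X :=
  Tape (to_left t) (a :: behead (from_head t)).

Definition shift (X : finType) (m : move) (t : tape X) : tape X :=
  match m with
  | MoveLeft =>
      Tape (behead (to_left t)) (head None (to_left t) :: from_head t)
  | Stay => t
  | MoveRight => Tape (read t :: to_left t) (behead (from_head t))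
  end.

(* The machine has tapes.+1 tapes and halts when delta returns None. *)
Record machine := Machine {
  tapes : nat;
  extra : finType;
  state : finType;
  start : state;
  delta : state -> {ffun 'I_tapes.+1 -> cell extra} ->
          option (state * {ffun 'I_tapes.+1 -> cell extra * move})
}.

Definition config (M : machine) :=
  (state M * {ffun 'I_(tapes M).+1 -> tape (extra M)})%type.

Definition step (M : machine) (c : config M) : option (config M) :=
  if delta c.1 [ffun i => read (c.2 i)] is Some (q, act)
  then Some (q, [ffun i => shift (act i).2 (write (act i).1 (c.2 i))])
  else None.

(* The halting configuration reached from c, if it is reached within n steps. *)
Fixpoint run (M : machine) (n : nat) (c : config M) : option (config M) :=
  if step c is Some c' then
    if n is m.+1 then run m c' else None
  else Some c.

Definition initial (M : machine) (w : word) : config M :=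
  (start M,
   [ffun i => Tape [::] (if i == ord0 then [seq Some (inl a) | a <- w]
                         else [::])]).

Fixpoint leading_word (X : finType) (s : seq (cell X)) : word :=
  if s is Some (inl a) :: s' then a :: leading_word s' else [::].

(* The output is read on the last tape, from the head rightwards, up to the
   first cell that carries no letter of the input/output alphabet. *)
Definition output (M : machine) (c : config M) : word :=
  leading_word (from_head (c.2 ord_max)).

Definition computes_within (M : machine) (w v : word) (n : nat) : Prop :=
  exists2 c, run n (initial M w) = Some c & output c = v.

(* The inputs of the problem are the codes of the data satisfying instance;
   the others carry no question. *)
Record problem := Problem {
  data : Type;
  encode : data -> word;
  encode_inj : injective encode;
  instance : data -> Prop;
  yes : data -> Prop
}.

Definition polynomial_time (P Q : problem) (f : data P -> data Q) : Prop :=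
  exists (M : machine) (p : {poly nat}), forall x : data P, instance x ->
    computes_within M (encode x) (encode (f x)) p.[size (encode x)]%R.

Definition polytime_reducible (P Q : problem) : Prop :=
  exists f : data P -> data Q,
    polynomial_time f /\
    forall x, instance x -> instance (f x) /\ (yes x <-> yes (f x)).

(* (true, v) is the variable of index v and (false, v) its negation. *)
Definition literal := (bool * nat)%type.
Definition clause := seq literal.
Definition cnf := seq clause.

Definition satisfies_cnf (a : nat -> bool) (phi : cnf) : bool :=
  all (has (fun l : literal => a l.2 == l.1)) phi.

Definition enc_literal (l : literal) : word := enc_bool l.1 ++ enc_nat l.2.
Definition enc_cnf : cnf -> word := enc_seq (enc_seq enc_literal).

Lemma enc_cnf_inj : injective enc_cnf.
Proof.
apply: self_delimiting_inj; apply: enc_seq_sd; last exact: enc_seq_nc.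
apply: enc_seq_sd; last by move=> x; eexists; last by eexists.
move=> [b m] [c n] s t; rewrite /enc_literal -!catA.
by move=> /enc_bool_sd [/= -> /enc_nat_sd [-> ->]].
Qed.

Definition threeSAT : problem := {|
  data := cnf;
  encode := enc_cnf;
  encode_inj := enc_cnf_inj;
  instance := fun phi => forall C : clause, C \in phi -> size C <= 3;
  yes := fun phi => exists a : nat -> bool, satisfies_cnf a phi
|}.

Definition itemset (K : nat) := {set 'I_K}.
Definition Omega (K : nat) : finType := {ffun 'I_K -> bool}.

Definition is_distribution (R : realType) (K : nat)
    (p : {ffun Omega K -> R}) : Prop :=
  (forall w, 0 <= p w)%R /\ (\sum_w p w = 1)%R.

Definition frequency (R : realType) (K : nat) (p : {ffun Omega K -> R})
    (B : itemset K) : R :=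
  (\sum_(w : Omega K | [forall i in B, w i]) p w)%R.

Definition satisfies_freq (R : realType) (K N : nat)
    (F : N.-tuple (itemset K)) (theta : N.-tuple rat)
    (p : {ffun Omega K -> R}) : Prop :=
  is_distribution p /\
  forall i : 'I_N, frequency p (tnth F i) = ratr (tnth theta i).

Definition consistent (R : realType) (K N : nat)
    (F : N.-tuple (itemset K)) (theta : N.-tuple rat) : Prop :=
  exists p : {ffun Omega K -> R}, satisfies_freq F theta p.

Definition antimonotonic (K : nat) (F : seq (itemset K)) : Prop :=
  forall X Y : itemset K, X \in F -> Y \subset X -> Y \in F.

Record mq_data := MQData {
  mq_K : nat;
  mq_N : nat;
  mq_family : mq_N.-tuple (itemset mq_K);
  mq_theta : mq_N.-tuple rat;
  mq_query : itemset mq_K;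
  mq_threshold : rat
}.

Definition enc_mq (x : mq_data) : word :=
  enc_nat (mq_K x) ++ enc_seq (@enc_set (mq_K x)) (mq_family x) ++
  enc_seq enc_rat (mq_theta x) ++
  enc_set (mq_query x) ++ enc_rat (mq_threshold x).

Lemma enc_mq_inj : injective enc_mq.
Proof.
move=> [K N F th B b] [K' N' F' th' B' b']; rewrite /enc_mq /=.
move=> /enc_nat_sd [eK]; case: K' / eK F' B' => F' B'.
move=> /(enc_seq_sd (@enc_set_sd K) (@enc_set_nc K)) [eF].
have eN : N = N' by rewrite -(size_tuple F) eF size_tuple.
case: N' / eN F' th' eF => F' th' /val_inj ->.
move=> /(enc_seq_sd enc_rat_sd enc_rat_nc) [/val_inj -> /enc_set_sd [->]].
by move=> /(self_delimiting_inj enc_rat_sd) ->.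
Qed.

Definition MaxQueryDec (R : realType) : problem := {|
  data := mq_data;
  encode := enc_mq;
  encode_inj := enc_mq_inj;
  instance := fun x =>
    [/\ 0 < mq_K x, uniq (mq_family x), antimonotonic (mq_family x)
      & consistent R (mq_family x) (mq_theta x)];
  yes := fun x => exists q : {ffun Omega (mq_K x) -> R},
    satisfies_freq (mq_family x) (mq_theta x) q /\
    (ratr (mq_threshold x) < frequency q (mq_query x))%R
|}.

(* Main.v *)
(* Proof idea.  The attributes are the positions of the input word; an occurrence
   of a literal is represented by the position of its sign, a clause by the
   position of its end, and the other positions are in no itemset.  Each literal
   occurrence has frequency 1/6, a clause of n literals n/6, a clause together
   with one of its literals 1/6, and two literals of one clause, or two
   complementary literals, never hold together.  So a clause attribute is almost
   surely the disjoint union of its literals, and a world of positive probability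
   in which all clause attributes hold selects literals that define a satisfying
   assignment.  Conversely, for an assignment a, six worlds of mass 1/6 indexed by
   a truth value and a rank in {0,1,2} realize the frequencies: an occurrence holds
   in the world given by its truth value under a and its rank in its clause.  This
   gives consistency; if a is satisfying, moving a true literal of each clause to
   rank 0 makes all clauses hold in the world (true, 0).
   The itemsets are listed by a five-tape machine, compiled from a small
   structured language, by a double loop over the positions. *)

(* The frequencies must be consistent for every formula, satisfiable or not, and computable without
   solving it; hence they depend on no assignment. The number six comes from the two kinds of
   exclusion: complementary literals are kept apart by their truth value (2 cases), literals of one
   clause by their rank (3 cases). Itemsets of size at most two suffice because of a mean value
   argument. A clause attribute has mean n/6, its conjunctions with its n literals have mean 1/6
   each and exclude one another; so the clause minus the sum of these conjunctions is nonnegative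
   with mean 0 and vanishes almost surely. The threshold can be 0, since one world of positive mass
   already yields an assignment. A position that stands for nothing may stay an attribute, since an
   antimonotonic family need not contain every singleton. *)
Require Import Defs.
From Corelib Require Import BinNums PosDef.
From mathcomp Require Import all_boot all_order all_algebra fingroup perm.
From mathcomp Require Import reals zify.

Set Implicit Arguments.
Unset Strict Implicit.
Unset Printing Implicit Defensive.

Import Order.TTheory GRing.Theory Num.Theory.

(** * Structured multi-tape programs *)

Section Commands.

Variables (n : nat) (X : finType).

Definition reads := {ffun 'I_n.+1 -> cell X}.
Definition acts := {ffun 'I_n.+1 -> cell X * move}.
Definition store := {ffun 'I_n.+1 -> tape X}.

Inductive cmd :=
| Act of reads -> acts
| Seq of cmd & cmd
| If of reads -> bool & cmd & cmd
| While of reads -> bool & cmd.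

Definition scan (T : store) : reads := [ffun i => read (T i)].
Definition idle (r : reads) : acts := [ffun i => (r i, Stay)].
Definition perform (T : store) (a : acts) : store :=
  [ffun i => shift (a i).2 (write (a i).1 (T i))].

(** In [If] and [While] the extra point [None] is the test, which takes a step of its own. When the
    body of a loop ends, [transition] therefore goes to [Some None], the test again. *)
Fixpoint pc (c : cmd) : finType :=
  match c with
  | Act _ => unit
  | Seq c1 c2 => (pc c1 + pc c2)%type
  | If _ c1 c2 => option (pc c1 + pc c2)
  | While _ c => option (pc c)
  end.

Fixpoint entry (c : cmd) : pc c :=
  match c with
  | Act _ => tt
  | Seq c1 c2 => inl (entry c1)
  | If _ _ _ => None
  | While _ _ => None
  end.

(* A control point of [None] means that the command has terminated. *)
Fixpoint transition (c : cmd) : pc c -> reads -> option (pc c) * acts :=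
  match c with
  | Act f => fun _ r => (None, f r)
  | Seq c1 c2 => fun q r =>
      match q with
      | inl q1 => let: (o, a) := transition q1 r in
          (Some (if o is Some q' then inl q' else inr (entry c2)), a)
      | inr q2 => let: (o, a) := transition q2 r in (omap inr o, a)
      end
  | If b c1 c2 => fun q r =>
      match q with
      | None =>
          (Some (Some (if b r then inl (entry c1) else inr (entry c2))), idle r)
      | Some (inl q1) => let: (o, a) := transition q1 r in
          (omap (fun q' => Some (inl q')) o, a)
      | Some (inr q2) => let: (o, a) := transition q2 r in
          (omap (fun q' => Some (inr q')) o, a)
      end
  | While b c => fun q r =>
      match q with
      | None => (if b r then Some (Some (entry c)) else None, idle r)
      | Some q1 => let: (o, a) := transition q1 r in (Some o, a)
      end
  end.

Definition cmd_step (c : cmd) (q : pc c) (T : store) : option (pc c) * store :=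
  let: (o, a) := transition q (scan T) in (o, perform T a).

Fixpoint cmd_run (c : cmd) (m : nat) (q : option (pc c)) (T : store) :
    option (pc c) * store :=
  match m, q with
  | m.+1, Some q' => let: (o, T') := cmd_step q' T in cmd_run m o T'
  | _, _ => (q, T)
  end.

Lemma cmd_run_None c m T : cmd_run m (None : option (pc c)) T = (None, T).
Proof. by case: m. Qed.

Lemma cmd_run_leq c m m' (q : option (pc c)) T T' :
  m <= m' -> cmd_run m q T = (None, T') -> cmd_run m' q T = (None, T').
Proof.
elim: m m' q T => [|m IH] [|m'] [q|] T //=.
by case: (cmd_step q T) => o T1 le; apply: IH.
Qed.

Lemma cmd_run_inr c1 c2 m q T T' :
  cmd_run m (Some q) T = (None, T') ->
  cmd_run m (Some (inr q : pc (Seq c1 c2))) T = (None, T').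
Proof.
elim: m q T => [|m IH] q T //=; rewrite /cmd_step /=.
case: (transition q (scan T)) => -[q'|] a /=; first exact: IH.
by rewrite !cmd_run_None => -[->].
Qed.

Lemma cmd_run_inl c1 c2 m m' q T T1 T' :
  cmd_run m (Some q) T = (None, T1) ->
  cmd_run m' (Some (entry c2)) T1 = (None, T') ->
  cmd_run (m + m') (Some (inl q : pc (Seq c1 c2))) T = (None, T').
Proof.
move=> + h2; elim: m q T => [|m IH] q T //=; rewrite /cmd_step /=.
case: (transition q (scan T)) => -[q'|] a /=; first exact: IH.
rewrite cmd_run_None => -[->].
apply: (@cmd_run_leq (Seq c1 c2)) (leq_addl m m') _.
exact: cmd_run_inr.
Qed.

Lemma cmd_run_If1 b c1 c2 m q T T' :
  cmd_run m (Some q) T = (None, T') ->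
  cmd_run m (Some (Some (inl q) : pc (If b c1 c2))) T = (None, T').
Proof.
elim: m q T => [|m IH] q T //=; rewrite /cmd_step /=.
case: (transition q (scan T)) => -[q'|] a /=; first exact: IH.
by rewrite !cmd_run_None => -[->].
Qed.

Lemma cmd_run_If2 b c1 c2 m q T T' :
  cmd_run m (Some q) T = (None, T') ->
  cmd_run m (Some (Some (inr q) : pc (If b c1 c2))) T = (None, T').
Proof.
elim: m q T => [|m IH] q T //=; rewrite /cmd_step /=.
case: (transition q (scan T)) => -[q'|] a /=; first exact: IH.
by rewrite !cmd_run_None => -[->].
Qed.

Lemma cmd_run_While b c m m' q T T1 T' :
  cmd_run m (Some q) T = (None, T1) ->
  cmd_run m' (Some (entry (While b c))) T1 = (None, T') ->
  cmd_run (m + m') (Some (Some q : pc (While b c))) T = (None, T').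
Proof.
move=> + h2; elim: m q T => [|m IH] q T //=; rewrite /cmd_step /=.
case: (transition q (scan T)) => -[q'|] a /=; first exact: IH.
rewrite cmd_run_None => -[->].
exact: (@cmd_run_leq (While b c)) (leq_addl m m') h2.
Qed.

(* Blanks beyond the stored part of a tape are invisible to the machine, but
   writing back a blank that was read stores it; stores are therefore compared
   after removal of the trailing blanks. *)
Definition bcons (a : cell X) (s : seq (cell X)) :=
  if (a, s) is (None, [::]) then [::] else a :: s.
Definition trim := foldr bcons [::].
Definition trim_tape (t : tape X) := Tape (trim (to_left t)) (trim (from_head t)).
Definition same_store (T T' : store) :=
  forall i, trim_tape (T i) = trim_tape (T' i).

Lemma head_trim s : head None (trim s) = head None s.
Proof. by case: s => [|[a|] s] //=; case: (trim s). Qed.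

Lemma trim_behead s : trim (behead s) = behead (trim s).
Proof. by case: s => [|[a|] s] //=; case: (trim s). Qed.

Lemma trim_read t t' : trim_tape t = trim_tape t' -> read t = read t'.
Proof. by move=> [_ h]; rewrite /read -head_trim h head_trim. Qed.

Lemma trim_write a t t' :
  trim_tape t = trim_tape t' -> trim_tape (write a t) = trim_tape (write a t').
Proof. by move=> [h1 h2]; rewrite /trim_tape /= h1 !trim_behead h2. Qed.

Lemma trim_shift m t t' :
  trim_tape t = trim_tape t' -> trim_tape (shift m t) = trim_tape (shift m t').
Proof.
move=> h; have [h1 h2] := h; have r := trim_read h.
case: m => //=; rewrite /trim_tape /= ?trim_behead ?h1 ?h2 ?r //.
by rewrite -(head_trim (to_left t)) h1 head_trim.
Qed.

Lemma trim_idle t : trim_tape (write (read t) t) = trim_tape t.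
Proof. by rewrite /trim_tape /write /read /=; case: (from_head t). Qed.

Lemma same_store_scan T T' : same_store T T' -> scan T = scan T'.
Proof. by move=> h; apply/ffunP => i; rewrite !ffunE; exact: trim_read. Qed.

Lemma same_store_idle T : same_store (perform T (idle (scan T))) T.
Proof. by move=> i; rewrite !ffunE /= trim_idle. Qed.

Lemma same_store_perform T T' a :
  same_store T T' -> same_store (perform T a) (perform T' a).
Proof. by move=> h i; rewrite !ffunE; apply/trim_shift/trim_write. Qed.

Lemma same_store_trans T1 T2 T3 :
  same_store T1 T2 -> same_store T2 T3 -> same_store T1 T3.
Proof. by move=> h h' i; rewrite h. Qed.

(** A total correctness triple with time bound [m]. It ranges over all stores equal to [T] up to
    trailing blanks because even a test rewrites the scanned cells; this is what lets the rules
    below compose. *)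
Definition exec (c : cmd) (T T' : store) (m : nat) :=
  forall T0, same_store T0 T ->
    exists2 T1, cmd_run m (Some (entry c)) T0 = (None, T1) & same_store T1 T'.

Lemma exec_leq c T T' m m' : m <= m' -> exec c T T' m -> exec c T T' m'.
Proof.
by move=> le h T0 /h [T1 r s]; exists T1 => //; apply: cmd_run_leq r.
Qed.

Lemma exec_Act f T T' :
  same_store (perform T (f (scan T))) T' -> exec (Act f) T T' 1.
Proof.
move=> h T0 h0; eexists; first by [].
rewrite (same_store_scan h0); apply: same_store_trans h.
exact: same_store_perform.
Qed.

Lemma exec_Seq c1 c2 T T1 T' m1 m2 :
  exec c1 T T1 m1 -> exec c2 T1 T' m2 -> exec (Seq c1 c2) T T' (m1 + m2).
Proof.
move=> h1 h2 T0 /h1 [T2 r1 /h2 [T3 r2 s]]; exists T3 => //.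
exact: cmd_run_inl r1 r2.
Qed.

Lemma exec_If b c1 c2 T T' m :
  exec (if b (scan T) then c1 else c2) T T' m -> exec (If b c1 c2) T T' m.+1.
Proof.
move=> h T0 h0 /=; rewrite /cmd_step /= (same_store_scan h0).
have [T1] := h _ (same_store_trans (@same_store_idle T0) h0).
rewrite -(same_store_scan h0) => r s; exists T1 => //.
case: (b _) r; [exact: cmd_run_If1 | exact: cmd_run_If2].
Qed.

Lemma exec_While0 b c T : ~~ b (scan T) -> exec (While b c) T T 1.
Proof.
move=> /negbTE h T0 h0; exists (perform T0 (idle (scan T0))).
  by rewrite /= /cmd_step /= (same_store_scan h0) h.
exact: same_store_trans (@same_store_idle T0) h0.
Qed.

Lemma exec_WhileS (b : reads -> bool) c T T1 T' m m' :
  b (scan T) -> exec c T T1 m -> exec (While b c) T1 T' m' ->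
  exec (While b c) T T' (m + m').+1.
Proof.
move=> bT h1 h2 T0 h0; rewrite /= /cmd_step /= (same_store_scan h0) bT.
have [T2] := h1 _ (same_store_trans (@same_store_idle T0) h0).
rewrite -(same_store_scan h0) => r1 /h2 [T3 r2 s]; exists T3 => //.
exact: cmd_run_While r1 r2.
Qed.

(** Here [S i] is the store after [i] rounds. Each round pays one step for its test, and the failing
    test one more. *)
Lemma exec_loop (b : reads -> bool) c (S : nat -> store) k m :
  (forall i, i < k -> b (scan (S i)) /\ exec c (S i) (S i.+1) m) ->
  ~~ b (scan (S k)) -> exec (While b c) (S 0) (S k) (k * m.+1).+1.
Proof.
(* Generalised to a start at any round [i], for an induction on the number [j] of rounds left. *)
move=> + hk; suff H j i : i + j = k ->
    (forall i, i < k -> b (scan (S i)) /\ exec c (S i) (S i.+1) m) ->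
    exec (While b c) (S i) (S k) (j * m.+1).+1.
  by move=> h; apply: (H k 0).
elim: j i => [|j IH] i eij h.
  by rewrite -eij addn0 in hk *; exact: exec_While0.
have [bi ci] : b (scan (S i)) /\ exec c (S i) (S i.+1) m by apply: h; lia.
rewrite mulSn addSn -addnS; apply: exec_WhileS bi ci _.
by apply: IH => //; lia.
Qed.

Lemma exec_same c T T1 T' m : same_store T T1 -> exec c T1 T' m -> exec c T T' m.
Proof. by move=> h e T0 h0; apply: e; apply: same_store_trans h0 h. Qed.

(** * Compilation to a Turing machine *)

Definition machine_of (c : cmd) : machine :=
  {| tapes := n; extra := X; state := option (pc c); start := Some (entry c);
     delta := fun q r => if q is Some q' then Some (transition q' r) else None |}.

Lemma machine_run (c : cmd) m q T T' :
  cmd_run m q T = (None, T') ->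
  @run (machine_of c) m (q, T) = Some (None, T').
Proof.
elim: m q T => [|m IH] [q|] T //=; rewrite ?cmd_run_None; try by move=> [->].
rewrite /step /=; have -> : [ffun i => read (T i)] = scan T by [].
rewrite /cmd_step; case: (transition q (scan T)) => o a /IH.
by congr (_ = _).
Qed.

(** A blank ends the output word, so knowing the final store up to trailing blanks is enough to know
    the output. *)
Lemma leading_trim s : @leading_word X (trim s) = leading_word s.
Proof.
elim: s => [|[[a|x]|] s IH] //=; rewrite ?IH //.
by case: (trim s).
Qed.

Lemma exec_computes c w T m :
  exec c [ffun i => Tape [::] (if i == ord0 then [seq Some (inl a) | a <- w]
                               else [::])] T m ->
  computes_within (machine_of c) w (leading_word (from_head (T ord_max))) m.
Proof.
move=> /(_ _ (fun i => erefl)) [T1 r s].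
exists ((None, T1) : config (machine_of c)); first exact: machine_run.
rewrite /output /= -leading_trim -[RHS]leading_trim.
by have [_ ->] := s ord_max.
Qed.

End Commands.

(** * Tapes holding words *)

Section Tapes.

Variable X : finType.
Local Notation letter := (symbol + X)%type.
Implicit Types (L : seq letter) (t : tape X) (w : word).

Definition at_pos (q : nat) L : tape X :=
  Tape (rev (map Some (take q L))) (map Some (drop q L)).

(** The head one cell to the left of [at_pos q L]. For [q = 0] it scans the blank before the word,
    which stays stored afterwards; moving right again restores [at_pos 0 L] only up to trailing
    blanks. *)
Definition before_pos (q : nat) L : tape X :=
  if q is q'.+1 then at_pos q' L else Tape [::] (None :: map Some L).

Definition written w : tape X := at_pos (size w) (map inl w).

Lemma read_at_pos q L : read (at_pos q L) = nth None (map Some L) q.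
Proof. by rewrite /read /= map_drop -nth0 nth_drop addn0. Qed.

Lemma read_at_posE x0 q L : q < size L -> read (at_pos q L) = Some (nth x0 L q).
Proof. by move=> h; rewrite read_at_pos (nth_map x0). Qed.

Lemma read_at_end q L : size L <= q -> read (at_pos q L) = None.
Proof. by move=> h; rewrite read_at_pos nth_default ?size_map. Qed.

Lemma right_at_pos q L :
  q < size L -> shift MoveRight (at_pos q L) = at_pos q.+1 L.
Proof.
move=> h; have x : letter by case: L h.
rewrite /at_pos /shift (take_nth x h) (drop_nth x h) /=.
by rewrite map_rcons rev_rcons.
Qed.

Lemma left_at_pos q L :
  q <= size L -> shift MoveLeft (at_pos q L) = before_pos q L.
Proof.
case: q => [|q] h; first by rewrite /at_pos take0 drop0.
have x : letter by case: L h.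
by rewrite -(right_at_pos h) /= /at_pos /read /= (drop_nth x h).
Qed.

Lemma right_before_pos q L :
  q <= size L ->
  trim_tape (shift MoveRight (before_pos q L)) = trim_tape (at_pos q L).
Proof.
case: q => [|q] h; last by rewrite right_at_pos.
by rewrite /at_pos /= take0 drop0.
Qed.

Lemma write_at_pos x0 q L a :
  q < size L -> write (Some a) (at_pos q L) = at_pos q (set_nth x0 L q a).
Proof.
move=> h; rewrite /write /at_pos /=; congr Tape.
  congr (rev (map _ _)); apply: (@eq_from_nth _ x0).
    by rewrite !size_takel ?size_set_nth; lia.
  move=> i; rewrite size_take h => hi.
  by rewrite !nth_take // nth_set_nth /=; case: eqP => //; lia.
have hs : q < size (set_nth x0 L q a) by rewrite size_set_nth; lia.
rewrite (drop_nth x0 hs) (drop_nth x0 h) /= nth_set_nth /= eqxx.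
congr (_ :: map _ _); apply: (@eq_from_nth _ x0).
  by rewrite !size_drop size_set_nth; lia.
by move=> i _; rewrite !nth_drop nth_set_nth /=; case: eqP => //; lia.
Qed.

Lemma append_at_pos L a :
  shift MoveRight (write (Some a) (at_pos (size L) L)) =
  at_pos (size L).+1 (rcons L a).
Proof.
rewrite /at_pos /write /shift take_size drop_size /=.
by rewrite -(size_rcons L a) take_size drop_size map_rcons rev_rcons.
Qed.

Lemma append_written w s :
  shift MoveRight (write (Some (inl s)) (written w)) = written (rcons w s).
Proof.
rewrite /written -(size_map (@inl _ X)) append_at_pos.
by rewrite -map_rcons !size_map size_rcons.
Qed.

(** A first component [None] keeps the scanned cell. Tapes beyond the end of a list of actions are
    left alone, through the default [keep]. *)
Definition letter_act := (option letter * move)%type.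
Definition act_on (p : letter_act) t :=
  shift p.2 (if p.1 is Some a then write (Some a) t else t).
Definition keep : letter_act := (None, Stay).
Definition go (m : move) : letter_act := (None, m).
Definition put (a : letter) : letter_act := (Some a, MoveRight).

Local Notation reads := (reads 4 X).
Local Notation cmd := (cmd 4 X).
Local Notation store := (store 4 X).

Definition Do (g : reads -> seq letter_act) : cmd :=
  Act (fun r => [ffun i : 'I_5 => let p := nth keep (g r) i in
    (if p.1 is Some a then Some a else r i, p.2)]).

Definition skip : cmd := Do (fun=> [::]).

Lemma exec_Do g (T T' : store) :
  (forall i : 'I_5, trim_tape (act_on (nth keep (g (scan T)) i) (T i)) =
                    trim_tape (T' i)) ->
  exec (Do g) T T' 1.
Proof.
move=> h; apply: exec_Act => i; rewrite !ffunE /= -h /act_on.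
case: (nth _ _ _) => [[a|] m] //=.
by apply: trim_shift; rewrite trim_idle.
Qed.

Lemma exec_skip T : exec skip T T 1.
Proof. by apply: exec_Do => i; rewrite nth_nil. Qed.

(* A holds the input and later its tokens, B the tokens with marks, T the list of
   frequencies, F the state of the tokenizer, and O the output. *)
Definition iA : 'I_5 := @Ordinal 5 0 isT.
Definition iB : 'I_5 := @Ordinal 5 1 isT.
Definition iT : 'I_5 := @Ordinal 5 2 isT.
Definition iF : 'I_5 := @Ordinal 5 3 isT.
Definition iO : 'I_5 := @Ordinal 5 4 isT.

Definition st (a b t f o : tape X) : store :=
  [ffun i : 'I_5 => nth a [:: a; b; t; f; o] i].

Lemma scan_st a b t f o :
  ((scan (st a b t f o) iA = read a) * (scan (st a b t f o) iB = read b) *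
   (scan (st a b t f o) iT = read t) * (scan (st a b t f o) iF = read f) *
   (scan (st a b t f o) iO = read o))%type.
Proof. by rewrite !ffunE. Qed.

Lemma exec_Do_st g a b t f o a' b' t' f' o' :
  (let s := g (scan (st a b t f o)) in
   act_on (nth keep s 0) a = a' /\ act_on (nth keep s 1) b = b' /\
   act_on (nth keep s 2) t = t' /\ act_on (nth keep s 3) f = f' /\
   act_on (nth keep s 4) o = o') ->
  exec (Do g) (st a b t f o) (st a' b' t' f' o') 1.
Proof.
rewrite /st /= => -[h0 [h1 [h2 [h3 h4]]]]; apply: exec_Do.
by case=> [[|[|[|[|[|k]]]]] hi] //; rewrite !ffunE /= ?h0 ?h1 ?h2 ?h3 ?h4.
Qed.

Definition upd (T : store) (i : 'I_5) t : store :=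
  [ffun j => if j == i then t else T j].

Lemma upd_A a b t f o x : upd (st a b t f o) iA x = st x b t f o.
Proof.
by apply/ffunP; case=> [[|[|[|[|[|k]]]]] hi] //; rewrite !ffunE /=.
Qed.

Lemma upd_B a b t f o x : upd (st a b t f o) iB x = st a x t f o.
Proof.
by apply/ffunP; case=> [[|[|[|[|[|k]]]]] hi] //; rewrite !ffunE /=.
Qed.

Lemma upd_T a b t f o x : upd (st a b t f o) iT x = st a b x f o.
Proof.
by apply/ffunP; case=> [[|[|[|[|[|k]]]]] hi] //; rewrite !ffunE /=.
Qed.

Lemma upd_F a b t f o x : upd (st a b t f o) iF x = st a b t x o.
Proof.
by apply/ffunP; case=> [[|[|[|[|[|k]]]]] hi] //; rewrite !ffunE /=.
Qed.

Lemma upd_O a b t f o x : upd (st a b t f o) iO x = st a b t f x.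
Proof.
by apply/ffunP; case=> [[|[|[|[|[|k]]]]] hi] //; rewrite !ffunE /=.
Qed.

Definition Op (i : 'I_5) (g : reads -> letter_act) : cmd :=
  Do (fun r => ncons i keep [:: g r]).

Lemma exec_Op i g T t :
  trim_tape (act_on (g (scan T)) (T i)) = trim_tape t ->
  exec (Op i g) T (upd T i t) 1.
Proof.
move=> ht; apply: exec_Do => j; rewrite !ffunE nth_ncons.
case: eqP => [->|ne]; first by rewrite ltnn subnn /=.
case: ltnP => // h; rewrite nth_default //= subn_gt0 ltn_neqAle h andbT.
by apply/eqP => e; apply: ne; apply: val_inj.
Qed.

Lemma exec_Op_eq i g T t :
  act_on (g (scan T)) (T i) = t -> exec (Op i g) T (upd T i t) 1.
Proof. by move=> h; apply: exec_Op; rewrite h. Qed.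

Lemma upd_upd T i t t' : upd (upd T i t) i t' = upd T i t'.
Proof. by apply/ffunP => j; rewrite !ffunE; case: eqP. Qed.

Lemma upd_id T i : upd T i (T i) = T.
Proof. by apply/ffunP => j; rewrite ffunE; case: eqP => // ->. Qed.

Lemma upd_same T i t : upd T i t i = t.
Proof. by rewrite ffunE eqxx. Qed.

Lemma scan_upd T i t : scan (upd T i t) i = read t.
Proof. by rewrite ffunE upd_same. Qed.

(** The first move is unconditional because the head may stand on the blank after the word; the last
    one corrects the overshoot onto the blank before it. *)
Definition rewind (i : 'I_5) : cmd :=
  Seq (Op i (fun=> go MoveLeft))
 (Seq (While (fun r => isSome (r i)) (Op i (fun=> go MoveLeft)))
      (Op i (fun=> go MoveRight))).

Lemma read_before_pos q L :
  q <= size L -> isSome (read (before_pos q L)) = (0 < q).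
Proof.
case: q => // q h; rewrite /=.
by case: L h => // x L h; rewrite (read_at_posE x).
Qed.

Lemma left_before_pos q L :
  q.+1 <= size L -> shift MoveLeft (before_pos q.+1 L) = before_pos q L.
Proof. by move=> h; apply: left_at_pos; apply: ltnW. Qed.

Lemma exec_rewind i (T : store) q L :
  T i = at_pos q L -> q <= size L ->
  exec (rewind i) T (upd T i (at_pos 0 L)) (2 * q + 3).
Proof.
move=> Ti hq.
have -> : 2 * q + 3 = 1 + ((q * 1.+1).+1 + 1) by lia.
apply: exec_Seq; first by apply: exec_Op_eq; rewrite Ti; exact: left_at_pos.
apply: exec_Seq; last first.
  rewrite -(upd_upd _ _ (before_pos 0 L)); apply: exec_Op.
  by rewrite upd_same; exact: right_before_pos.
have /= := @exec_loop _ _ (fun r : reads => isSome (r i))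
  (Op i (fun=> go MoveLeft)) (fun k => upd T i (before_pos (q - k) L)) q 1.
rewrite subn0 subnn => h; apply: h; last by rewrite scan_upd.
move=> k hk; rewrite scan_upd read_before_pos ?subn_gt0; last by lia.
split=> //; rewrite -[X in exec _ _ X](upd_upd _ _ (before_pos (q - k) L)).
apply: exec_Op_eq; rewrite upd_same.
have -> : q - k = (q - k.+1).+1 by lia.
by apply: left_before_pos; lia.
Qed.

Definition puts (i : 'I_5) w : cmd :=
  foldr (fun s c => Seq (Op i (fun=> put (inl s))) c) skip w.

Lemma exec_puts i w (T : store) v :
  T i = written v ->
  exec (puts i w) T (upd T i (written (v ++ w))) (size w).+1.
Proof.
elim: w T v => [|s w IH] T v Ti; first by rewrite cats0 -Ti upd_id; exact: exec_skip.
apply: (@exec_Seq _ _ _ _ _ _ _ 1).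
  by apply: exec_Op_eq; rewrite Ti; exact: append_written.
rewrite -cat_rcons -[X in exec _ _ X](upd_upd _ _ (written (rcons v s))).
by apply: IH; rewrite upd_same.
Qed.

Lemma exec_rewind_A q L (b t f o : tape X) : q <= size L ->
  exec (rewind iA) (st (at_pos q L) b t f o) (st (at_pos 0 L) b t f o) (2 * q + 3).
Proof.
move=> h; rewrite -[X in exec _ _ X](upd_A (at_pos q L)).
by apply: exec_rewind h; rewrite ffunE.
Qed.

Lemma exec_rewind_B q L (a t f o : tape X) : q <= size L ->
  exec (rewind iB) (st a (at_pos q L) t f o) (st a (at_pos 0 L) t f o) (2 * q + 3).
Proof.
move=> h; rewrite -[X in exec _ _ X](upd_B _ (at_pos q L)).
by apply: exec_rewind h; rewrite ffunE.
Qed.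

Lemma exec_rewind_T q L (a b f o : tape X) : q <= size L ->
  exec (rewind iT) (st a b (at_pos q L) f o) (st a b (at_pos 0 L) f o) (2 * q + 3).
Proof.
move=> h; rewrite -[X in exec _ _ X](upd_T _ _ (at_pos q L)).
by apply: exec_rewind h; rewrite ffunE.
Qed.

Lemma exec_rewind_O q L (a b t f : tape X) : q <= size L ->
  exec (rewind iO) (st a b t f (at_pos q L)) (st a b t f (at_pos 0 L)) (2 * q + 3).
Proof.
move=> h; rewrite -[X in exec _ _ X](upd_O _ _ _ _ (at_pos q L)).
by apply: exec_rewind h; rewrite ffunE.
Qed.

Lemma exec_write_T v w (a b f o : tape X) :
  exec (puts iT w) (st a b (written v) f o)
    (st a b (written (v ++ w)) f o) (size w).+1.
Proof.
rewrite -[X in exec _ _ X](upd_T _ _ (written v)).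
by apply: exec_puts; rewrite ffunE.
Qed.

Lemma exec_write_O v w (a b t f : tape X) :
  exec (puts iO w) (st a b t f (written v))
    (st a b t f (written (v ++ w))) (size w).+1.
Proof.
rewrite -[X in exec _ _ X](upd_O _ _ _ _ (written v)).
by apply: exec_puts; rewrite ffunE.
Qed.

End Tapes.

(** * Listing the itemsets *)

Definition token : finType := ((bool + bool) + option 'I_4)%type.
Definition Lit (b : bool) : token := inl (inl b).
Definition Dig (b : bool) : token := inl (inr b).
Definition Cls (n : 'I_4) : token := inr (Some n).
Definition Dummy : token := inr None.

Definition lit_sign (t : token) : option bool :=
  if t is inl (inl b) then Some b else None.
Definition is_dig (t : token) := if t is inl (inr _) then true else false.
Definition is_cls (t : token) := if t is inr (Some _) then true else false.

(* A flag (in_clause, in_inner, n) is the state of the left-to-right pass that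
   turns the input into tokens; n counts the literals of the current clause. *)
Definition flag : finType := (bool * bool * 'I_4)%type.
Definition aux : finType := (token * bool + flag)%type.
Definition marked (t : token) (m : bool) : symbol + aux := inr (inl (t, m)).

Definition token_of (c : cell aux) : option token :=
  if c is Some (inr (inl (t, _))) then Some t else None.
Definition mark_of (c : cell aux) : bool :=
  if c is Some (inr (inl (_, m))) then m else false.

(** * Longest common prefix of two digit strings *)

(** The number of rounds in which [compare_variables] sees equal digits. *)
Fixpoint lcp (s t : seq bool) : nat :=
  match s, t with
  | x :: s', y :: t' => if x == y then (lcp s' t').+1 else 0
  | _, _ => 0
  end.

Lemma lcp_size s t : lcp s t <= size s /\ lcp s t <= size t.
Proof. by elim: s t => [|x s IH] [|y t] //=; case: eqP => //= _; have := IH t; lia. Qed.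

Lemma nth_lcp s t i : i < lcp s t -> nth false s i = nth false t i.
Proof.
elim: s t i => [|x s IH] [|y t] //= i; case: eqP => //= ->.
by case: i => //= i; exact: IH.
Qed.

Lemma lcp_eq s t : s = t -> lcp s t = size s.
Proof. by move=> <-; elim: s => //= x s ->; rewrite eqxx. Qed.

Lemma lcp_neq s t : s <> t -> lcp s t < size s -> lcp s t < size t ->
  nth false s (lcp s t) <> nth false t (lcp s t).
Proof.
elim: s t => [|x s IH] [|y t] //=; case: eqP => //= -> h h1 h2.
by apply: IH => // e; apply: h; rewrite e.
Qed.

Lemma lcp_end s t : lcp s t = size s -> lcp s t = size t -> s = t.
Proof.
elim: s t => [|x s IH] [|y t] //=; case: eqP => //= -> [h1] [h2].
by rewrite (IH t).
Qed.

(* An itemset, given by its positions, and its frequency in sixths. *)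
Definition item := (seq nat * nat)%type.

Definition theta_of (n : nat) : rat := (n%:R / 6%:R)%R.

(** Every frequency is n/6 with [n < 7], so its code has a length bounded independently of the
    input. *)
Definition theta_cost := \max_(n < 7) size (enc_rat (theta_of n)).

(** * Commands that list the itemsets *)

Definition goB (m : move) : cmd 4 aux := Op iB (fun=> go aux m).

Definition set_mark (m : bool) : cmd 4 aux :=
  Op iB (fun r => (omap (fun t => marked t m) (token_of (r iB)), Stay)).

Definition copy_marks : cmd 4 aux :=
  While (fun r => isSome (r iB))
    (Do (fun r => [:: keep aux; go aux MoveRight; keep aux; keep aux;
                   put (inl (Bit (mark_of (r iB))))])).

Definition list_item (n : nat) : cmd 4 aux :=
  Seq (puts aux iT (enc_rat (theta_of n)))
 (Seq (puts aux iO [:: Open])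
 (Seq (rewind aux iB) (Seq copy_marks (puts aux iO [:: Close])))).

(** Copying the marks takes the head of B to the end of the tape. The position it came from is the
    rightmost mark, so no further memory is needed to find it again. *)
Definition to_last_mark : cmd 4 aux :=
  Seq (goB MoveLeft) (While (fun r => ~~ mark_of (r iB)) (goB MoveLeft)).

Definition emit (n : nat) : cmd 4 aux :=
  Seq (set_mark true) (Seq (list_item n) to_last_mark).

Definition both (m : move) : cmd 4 aux := Do (fun=> [:: go aux m; go aux m]).

Definition same_digit (r : reads 4 aux) : bool :=
  (token_of (r iA) == token_of (r iB)) && oapp is_dig false (token_of (r iA)).

Definition no_digit (r : reads 4 aux) : bool :=
  ~~ oapp is_dig false (token_of (r iA)) && ~~ oapp is_dig false (token_of (r iB)).

(** Only A is tested: both heads left the signs of two literals and moved in step, so B is back when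
    A is. *)
Definition return_both : cmd 4 aux :=
  While (fun r => ~~ isSome (obind lit_sign (token_of (r iA)))) (both MoveLeft).

(** The first two moves pass the sign and the bracket that opens the number. The variables are equal
    exactly when both numbers end where the common digits end. The heads return before [emit], which
    marks the cell under B. *)
Definition compare_variables : cmd 4 aux :=
  Seq (both MoveRight) (Seq (both MoveRight) (Seq (While same_digit (both MoveRight))
    (If no_digit (Seq return_both (Seq (emit 0) (set_mark false))) return_both))).

Definition is_literal (c : cell aux) : bool := obind lit_sign (token_of c).
Definition is_clause (c : cell aux) : bool := oapp is_cls false (token_of c).

Definition emit_pair (n : nat) : cmd 4 aux := Seq (emit n) (set_mark false).

Definition complementary (r : reads 4 aux) : bool :=
  if (obind lit_sign (token_of (r iA)), obind lit_sign (token_of (r iB)))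
  is (Some b, Some b') then b != b' else false.

Definition same_clause_loop : cmd 4 aux :=
  While (fun r => ~~ is_clause (r iB))
    (Seq (If (fun r => is_literal (r iB)) (emit_pair 0) (skip aux))
         (goB MoveRight)).

Definition other_clauses_loop : cmd 4 aux :=
  While (fun r => isSome (r iB))
    (Seq (If complementary compare_variables (skip aux)) (goB MoveRight)).

(** B visits every position after the current literal once: literals before the end of the clause
    get 0, the end itself gets 1/6, and beyond it only complementary literals of the same variable
    are listed. Pairs with an earlier literal were listed when A stood there. *)
Definition list_pairs : cmd 4 aux :=
  Seq (goB MoveRight) (Seq same_clause_loop (Seq (emit_pair 1)
    (Seq (goB MoveRight) (Seq other_clauses_loop to_last_mark)))).

(** A frequency is written by a fixed command, so the clause length stored in the token is turned
    into control by branching over its possible values. *)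
Definition emit_clause (s : seq 'I_4) : cmd 4 aux :=
  foldr (fun n c => If (fun r => token_of (r iA) == Some (Cls n))
                       (emit_pair n) c) (skip aux) s.

Definition list_position : cmd 4 aux :=
  Seq (If (fun r => is_literal (r iA))
          (Seq (emit 1) (Seq list_pairs (set_mark false)))
          (emit_clause (enum 'I_4)))
      (both MoveRight).

Definition list_positions : cmd 4 aux :=
  While (fun r => isSome (r iA)) list_position.

(* [bits p] are the digits of the variable of the literal at position p. *)
Definition literal_layout (K : nat) (ts : seq token) (bits : nat -> seq bool) :=
  forall p b, lit_sign (nth Dummy ts p) = Some b ->
  [/\ nth Dummy ts p.+1 = Dummy,
      forall d, d < size (bits p) ->
        nth Dummy ts (p + 2 + d) = Dig (nth false (bits p) d),
      nth Dummy ts (p + 2 + size (bits p)) = Dummy &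
      p + 2 + size (bits p) < K].

(* [cl p] is the end of the clause that contains the literal at position p. *)
Definition clause_layout (K : nat) (ts : seq token) (cl : nat -> nat) :=
  forall p b, lit_sign (nth Dummy ts p) = Some b ->
  [/\ p < cl p, cl p < K, is_cls (nth Dummy ts (cl p)) &
      forall q, p < q < cl p -> ~~ is_cls (nth Dummy ts q)].

(** * Correctness and cost of the listing *)

Section Pairs.

Variables (K : nat) (ts : seq token) (bits : nat -> seq bool) (cl : nat -> nat).
Local Notation tk := (nth Dummy ts).

Hypothesis literalP : literal_layout K ts bits.
Hypothesis clP : clause_layout K ts cl.

Definition marks (ps : seq nat) : seq (symbol + aux) :=
  [seq marked (tk i) (i \in ps) | i <- iota 0 K].

Lemma size_marks ps : size (marks ps) = K.
Proof. by rewrite size_map size_iota. Qed.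

Lemma nth_marks x0 ps q : q < K -> nth x0 (marks ps) q = marked (tk q) (q \in ps).
Proof. by move=> h; rewrite (nth_map 0) ?size_iota // nth_iota. Qed.

Definition tok_tape q ps : tape aux := at_pos q (marks ps).

Lemma read_tok q ps :
  read (tok_tape q ps) = if q < K then Some (marked (tk q) (q \in ps)) else None.
Proof.
case: ltnP => h; last by rewrite read_at_end ?size_marks.
by rewrite (read_at_posE (marked Dummy false)) ?nth_marks // size_marks.
Qed.

Lemma right_tok q ps :
  q < K -> shift MoveRight (tok_tape q ps) = tok_tape q.+1 ps.
Proof. by move=> h; rewrite /tok_tape right_at_pos ?size_marks. Qed.

Lemma left_tok q ps :
  q < K -> shift MoveLeft (tok_tape q.+1 ps) = tok_tape q ps.
Proof. by move=> h; rewrite /tok_tape left_at_pos ?size_marks. Qed.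

Lemma write_tok q ps ps' m :
  q < K -> (q \in ps') = m -> (forall i, i != q -> (i \in ps') = (i \in ps)) ->
  write (Some (marked (tk q) m)) (tok_tape q ps) = tok_tape q ps'.
Proof.
move=> hq hm h; rewrite /tok_tape (write_at_pos (marked Dummy false)) ?size_marks //.
congr at_pos; apply: (@eq_from_nth _ (marked Dummy false)).
  by rewrite size_set_nth !size_marks; lia.
move=> i; rewrite size_set_nth size_marks => hi; have {}hi : i < K by lia.
by rewrite nth_set_nth /= !nth_marks //; case: eqP => [->|/eqP /h ->]; rewrite ?hm.
Qed.

Definition mark_word (ps : seq nat) : word :=
  enc_seq enc_bool [seq i \in ps | i <- iota 0 K].

Variables (fl : tape aux) (w0 : word).

Definition theta_word (its : seq item) : word :=
  Open :: flatten [seq enc_rat (theta_of it.2) | it <- its].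
Definition family_word (its : seq item) : word :=
  w0 ++ Open :: flatten [seq mark_word it.1 | it <- its].

Definition cfg pa qb ps its : store 4 aux :=
  st (tok_tape pa [::]) (tok_tape qb ps) (written aux (theta_word its)) fl
     (written aux (family_word its)).

Lemma exec_set_mark pa q ps ps' m its :
  q < K -> (q \in ps') = m -> (forall i, i != q -> (i \in ps') = (i \in ps)) ->
  exec (set_mark m) (cfg pa q ps its) (cfg pa q ps' its) 1.
Proof.
move=> hq hm h; rewrite /cfg -[X in exec _ _ X](upd_B _ (tok_tape q ps)); apply: exec_Op_eq.
by rewrite !scan_st !ffunE /= read_tok hq; apply: write_tok.
Qed.

Lemma exec_mark pa q ps its :
  q < K -> exec (set_mark true) (cfg pa q ps its) (cfg pa q (q :: ps) its) 1.
Proof.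
move=> hq; apply: exec_set_mark; rewrite // ?inE ?eqxx //.
by move=> i /negbTE h; rewrite inE h.
Qed.

Lemma exec_unmark pa q ps its :
  q < K -> q \notin ps ->
  exec (set_mark false) (cfg pa q (q :: ps) its) (cfg pa q ps its) 1.
Proof.
move=> hq /negbTE hn; apply: exec_set_mark => // i /negbTE h.
by rewrite inE h.
Qed.

Lemma exec_go_left pa q ps its :
  q < K ->
  exec (goB MoveLeft) (cfg pa q.+1 ps its) (cfg pa q ps its) 1.
Proof.
move=> hq; rewrite /cfg -[X in exec _ _ X](upd_B _ (tok_tape q.+1 ps)); apply: exec_Op_eq.
by rewrite !ffunE; exact: left_tok.
Qed.

Lemma exec_go_right pa q ps its :
  q < K ->
  exec (goB MoveRight) (cfg pa q ps its) (cfg pa q.+1 ps its) 1.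
Proof.
move=> hq; rewrite /cfg -[X in exec _ _ X](upd_B _ (tok_tape q ps)); apply: exec_Op_eq.
by rewrite !ffunE; exact: right_tok.
Qed.

Lemma exec_to_last_mark pa q0 q ps its :
  q < q0 <= K -> q \in ps -> (forall i, q < i -> i \notin ps) ->
  exec to_last_mark (cfg pa q0 ps its) (cfg pa q ps its) (2 * K + 2).
Proof.
move=> /andP[h0 h1] hq hps.
have [k ek] : exists k, q0 = (q + k).+1 by exists (q0 - q).-1; lia.
apply: (@exec_leq _ _ _ _ _ (1 + (k * 1.+1).+1)); first by lia.
rewrite ek in h1 *; apply: exec_Seq; first by apply: exec_go_left; lia.
have := @exec_loop _ _ (fun r : reads 4 aux => ~~ mark_of (r iB))
  (goB MoveLeft) (fun i => cfg pa (q + k - i) ps its) k 1.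
rewrite subn0 addnK => h; apply: h; last first.
  by rewrite /cfg scan_st read_tok (_ : q < K) /= ?hq //; lia.
move=> i hi; split.
  rewrite /cfg scan_st read_tok (_ : q + k - i < K) /=; last by lia.
  by apply: hps; lia.
have -> : q + k - i = (q + k - i.+1).+1 by lia.
by apply: exec_go_left; lia.
Qed.

Lemma enc_bitsE s : enc_seq enc_bool s = Open :: map Bit s ++ [:: Close].
Proof. by rewrite /enc_seq; congr (_ :: _ ++ _); elim: s => //= b s ->. Qed.

Lemma iota_rcons m n : iota m n.+1 = rcons (iota m n) (m + n).
Proof. by rewrite -addn1 iotaD cats1. Qed.

Lemma exec_copy_marks a t f ps v :
  exec copy_marks (st a (tok_tape 0 ps) t f (written aux v))
    (st a (tok_tape K ps) t f
        (written aux (v ++ map Bit [seq i \in ps | i <- iota 0 K])))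
    (2 * K + 1).
Proof.
have := @exec_loop _ _ (fun r : reads 4 aux => isSome (r iB))
  (Do (fun r => [:: keep aux; go aux MoveRight; keep aux; keep aux;
                   put (inl (Bit (mark_of (r iB))))]))
  (fun k => st a (tok_tape k ps) t f
    (written aux (v ++ map Bit [seq i \in ps | i <- iota 0 k]))) K 1.
rewrite cats0 (_ : (K * 2).+1 = 2 * K + 1); last by lia.
apply; last by rewrite scan_st read_tok ltnn.
move=> i hi; rewrite scan_st read_tok hi; split => //.
rewrite iota_rcons !map_rcons -rcons_cat -append_written.
apply: exec_Do_st; rewrite /= scan_st read_tok hi.
by split=> //; split; first exact: right_tok.
Qed.

Lemma exec_list_item pa q ps its n :
  q <= K -> n < 7 ->
  exec (list_item n) (cfg pa q ps its) (cfg pa K ps (rcons its (ps, n)))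
    (theta_cost + 4 * K + 10).
Proof.
move=> hq hn.
have hc : size (enc_rat (theta_of n)) <= theta_cost.
  exact: (@leq_bigmax _ (fun n : 'I_7 => size (enc_rat (theta_of n))) (Ordinal hn)).
apply: (@exec_leq _ _ _ _ _ ((size (enc_rat (theta_of n))).+1 +
   (2 + ((2 * q + 3) + ((2 * K + 1) + 2))))); first by lia.
apply: (@exec_Seq _ _ _ _ _ (st (tok_tape pa [::]) (tok_tape q ps)
  (written aux (theta_word (rcons its (ps, n)))) fl
  (written aux (family_word its)))).
  by rewrite /theta_word map_rcons flatten_rcons -cat_cons; exact: exec_write_T.
rewrite /cfg; have -> : family_word (rcons its (ps, n)) = ((family_word its ++ [:: Open]) ++
    map Bit [seq i \in ps | i <- iota 0 K]) ++ [:: Close].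
  rewrite /family_word map_rcons flatten_rcons -cat_cons /mark_word.
  by rewrite enc_bitsE -!catA.
apply: exec_Seq; first exact: exec_write_O.
apply: exec_Seq; first by apply: exec_rewind_B; rewrite size_marks.
apply: exec_Seq; first exact: exec_copy_marks.
exact: exec_write_O.
Qed.

Definition emit_cost := theta_cost + 6 * K + 20.

(** No mark may lie to the right of [q], so that the return to the last mark ends at [q]. *)
Lemma exec_emit pa q ps its n :
  q < K -> n < 7 -> (forall i, q < i -> i \notin ps) ->
  exec (emit n) (cfg pa q ps its) (cfg pa q (q :: ps) (rcons its (q :: ps, n)))
    emit_cost.
Proof.
move=> hq hn hps.
apply: (@exec_leq _ _ _ _ _ (1 + ((theta_cost + 4 * K + 10) + (2 * K + 2)))).
  by rewrite /emit_cost; lia.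
apply: exec_Seq; first exact: exec_mark.
apply: exec_Seq; first by apply: exec_list_item => //; apply: ltnW.
apply: exec_to_last_mark; rewrite ?hq ?leqnn ?inE ?eqxx // => i hi.
by rewrite inE negb_or hps // andbT; lia.
Qed.

Definition conflict p q : bool :=
  if (lit_sign (tk p), lit_sign (tk q)) is (Some b, Some b')
  then (b != b') && (bits p == bits q) else false.

Lemma exec_both_right pa qb ps its :
  pa < K -> qb < K ->
  exec (both MoveRight) (cfg pa qb ps its) (cfg pa.+1 qb.+1 ps its) 1.
Proof.
by move=> ha hb; apply: exec_Do_st; split; [|split=> //]; exact: right_tok.
Qed.

Lemma exec_both_left pa qb ps its :
  pa < K -> qb < K ->
  exec (both MoveLeft) (cfg pa.+1 qb.+1 ps its) (cfg pa qb ps its) 1.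
Proof.
by move=> ha hb; apply: exec_Do_st; split; [|split=> //]; exact: left_tok.
Qed.

Lemma token_A pa qb ps its :
  pa < K -> token_of (scan (cfg pa qb ps its) iA) = Some (tk pa).
Proof. by move=> h; rewrite /cfg scan_st read_tok h. Qed.

Lemma token_B pa qb ps its :
  qb < K -> token_of (scan (cfg pa qb ps its) iB) = Some (tk qb).
Proof. by move=> h; rewrite /cfg scan_st read_tok h. Qed.

Lemma exec_return p q d ps its b :
  lit_sign (tk p) = Some b -> d <= size (bits p) -> q + 2 + d < K ->
  exec return_both (cfg (p + 2 + d) (q + 2 + d) ps its) (cfg p q ps its)
    (2 * d + 5).
Proof.
move=> hp hd hq; have [h1 h2 h3 h4] := literalP hp.
have := @exec_loop _ _
  (fun r : reads 4 aux => ~~ isSome (obind lit_sign (token_of (r iA))))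
  (both MoveLeft)
  (fun i => cfg (p + 2 + d - i) (q + 2 + d - i) ps its) (2 + d) 1.
have -> : p + 2 + d - (2 + d) = p by lia.
have -> : q + 2 + d - (2 + d) = q by lia.
rewrite !subn0 (_ : ((2 + d) * 2).+1 = 2 * d + 5); last by lia.
apply=> [i hi|]; last by rewrite token_A /= ?hp //; lia.
rewrite token_A; last by lia.
split; last first.
  have -> : p + 2 + d - i = (p + 2 + d - i.+1).+1 by lia.
  have -> : q + 2 + d - i = (q + 2 + d - i.+1).+1 by lia.
  by apply: exec_both_left; lia.
(* The cells passed on the way back are the opening bracket, digits and possibly the end of the
   number; none of them is a sign, so A cannot stop before [p]. *)
have [e|e] : p + 2 + d - i = p.+1 \/ exists d', p + 2 + d - i = p + 2 + d' /\ d' <= d.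
  by case: (eqVneq i d.+1) => [->|/eqP ne]; [left; lia|right; exists (d - i); lia].
  by rewrite e /= h1.
case: e => d' [-> hd'] /=; case: (ltnP d' (size (bits p))) => h; first by rewrite h2.
have ed : d' = size (bits p) by lia.
by rewrite ed h3.
Qed.

Lemma exec_compare_variables p q b b' its :
  p < q -> lit_sign (tk p) = Some b -> lit_sign (tk q) = Some b' ->
  exec compare_variables (cfg p q [:: p] its)
    (cfg p q [:: p] (if bits p == bits q then rcons its ([:: q; p], 0) else its))
    (emit_cost + 4 * K + 20).
Proof.
move=> pq hp hq; have [p1 p2 p3 p4] := literalP hp.
have [q1 q2 q3 q4] := literalP hq.
have [d1 d2] := lcp_size (bits p) (bits q).
set d := lcp _ _ in d1 d2.
have tokd i : i < d -> tk (p + 2 + i) = tk (q + 2 + i) /\ is_dig (tk (p + 2 + i)).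
  by move=> hi; rewrite p2 ?q2 ?(nth_lcp hi) //; lia.
have pK : p + 2 + d < K by lia.
have qK : q + 2 + d < K by lia.
apply: (@exec_leq _ _ _ _ _
  (1 + (1 + ((d * 1.+1).+1 + ((2 * d + 5) + (emit_cost + 1)).+1)))); first by lia.
apply: exec_Seq; first by apply: exec_both_right; lia.
apply: exec_Seq; first by apply: exec_both_right; lia.
apply: (@exec_Seq _ _ _ _ _ (cfg (p + 2 + d) (q + 2 + d) [:: p] its)).
  have := @exec_loop _ _ same_digit (both MoveRight)
    (fun i => cfg (p + 2 + i) (q + 2 + i) [:: p] its) d 1.
  rewrite -[p.+2]addn2 -[q.+2]addn2 !addn0; apply=> [i hi|].
    split; last by rewrite !(addnS _ i); apply: exec_both_right; lia.
    have [e1 e2] := tokd i hi.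
    rewrite /same_digit token_A ?token_B; try lia.
    by rewrite -e1 eqxx /= e2.
  (* After [d] rounds one of the numbers has ended, on a [Dummy], or the two digits differ. *)
  rewrite /same_digit token_A ?token_B; try lia.
  rewrite /=; case: (ltnP d (size (bits p))) => hd; last first.
    have ed : d = size (bits p) by lia.
    by rewrite -ed in p3; rewrite p3 andbF.
  rewrite p2 //; case: (ltnP d (size (bits q))) => hd'; last first.
    have ed : d = size (bits q) by lia.
    by rewrite -ed in q3; rewrite q3.
  rewrite q2 // andbT; apply/eqP => -[/eqP]; apply/negP; apply/eqP.
  by apply: lcp_neq => // e; have := lcp_eq e; rewrite -/d; lia.
apply: exec_If.
(* If both numbers end at offset [d], the common prefix is all of both. *)
have -> : no_digit (scan (cfg (p + 2 + d) (q + 2 + d) [:: p] its)) = (bits p == bits q).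
  rewrite /no_digit token_A ?token_B //=; apply/idP/eqP => [|e]; last first.
    have ed : d = size (bits p) by exact: lcp_eq.
    have ed' : d = size (bits q) by rewrite -e.
    by rewrite -ed in p3; rewrite -ed' in q3; rewrite p3 q3.
  case: (ltnP d (size (bits p))) => hd; first by rewrite p2.
  case: (ltnP d (size (bits q))) => hd'; first by rewrite (q2 _ hd') andbF.
  by move=> _; apply: lcp_end; rewrite -/d; lia.
have hr its' := @exec_return p q d [:: p] its' b hp d1 qK.
case: eqP => _; last by apply: exec_leq _ (hr _); lia.
apply: exec_Seq; first exact: hr.
apply: exec_Seq; first by apply: exec_emit => //; [lia | move=> i hi; rewrite inE; lia].
by apply: exec_unmark; rewrite ?inE; lia.
Qed.

(** What the loops do at [q], expressed by positions alone; [pair_valueE] translates it into clauses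
    and literals. *)
Definition pair_value p q : option nat :=
  if q < cl p then if lit_sign (tk q) is Some _ then Some 0 else None
  else if q == cl p then Some 1
  else if conflict p q then Some 0 else None.

Definition pairs p m : seq item :=
  pmap (fun q => omap (pair [:: q; p]) (pair_value p q)) (iota p.+1 m).

Lemma pairsS p m : pairs p m.+1 =
  pairs p m ++ seq_of_opt (omap (pair [:: p.+1 + m; p]) (pair_value p (p.+1 + m))).
Proof.
by rewrite /pairs iota_rcons -cats1 pmap_cat /=; case: (pair_value _ _).
Qed.

Definition position_items p : seq item :=
  match tk p with
  | inl (inl _) => ([:: p], 1) :: pairs p (K - p.+1)
  | inr (Some n) => [:: ([:: p], nat_of_ord n)]
  | _ => [::]
  end.

Lemma exec_emit_pair pa q ps its n :
  q < K -> n < 7 -> (forall i, q <= i -> i \notin ps) ->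
  exec (emit_pair n) (cfg pa q ps its) (cfg pa q ps (rcons its (q :: ps, n)))
    (emit_cost + 1).
Proof.
move=> hq hn hps; apply: exec_Seq; last by apply: exec_unmark => //; apply: hps.
by apply: exec_emit => // i hi; apply: hps; apply: ltnW.
Qed.

Lemma exec_same_clause_loop p b its :
  lit_sign (tk p) = Some b ->
  exec same_clause_loop (cfg p p.+1 [:: p] its)
    (cfg p (cl p) [:: p] (its ++ pairs p (cl p - p.+1)))
    (K * (emit_cost + 5)).+1.
Proof.
move=> hp; have [c1 c2 c3 c4] := clP hp.
have := @exec_loop _ _ (fun r : reads 4 aux => ~~ is_clause (r iB))
  (Seq (If (fun r : reads 4 aux => is_literal (r iB)) (emit_pair 0) (skip aux))
       (goB MoveRight))
  (fun i => cfg p (p.+1 + i) [:: p] (its ++ pairs p i)) (cl p - p.+1) (emit_cost + 3).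
rewrite subnKC // addn0 cats0 => h.
apply: exec_leq _ (h _ _); last by rewrite /is_clause token_B //= c3.
  by rewrite ltnS leq_mul //; lia.
move=> i hi; rewrite /is_clause token_B; last by lia.
split; first by apply: c4; lia.
have -> : emit_cost + 3 = (emit_cost + 1).+1 + 1 by lia.
rewrite addnS; apply: exec_Seq; last by apply: exec_go_right; lia.
apply: exec_If; rewrite /is_literal token_B /=; last by lia.
rewrite pairsS /pair_value (_ : _ < cl p); last by lia.
case: (lit_sign _) => [b'|] /=; last first.
  by rewrite cats0; apply: exec_leq _ (@exec_skip _ _); lia.
rewrite catA cats1; apply: exec_emit_pair => // [|j]; first by lia.
by rewrite inE; lia.
Qed.

Lemma exec_other_clauses_loop p b its :
  lit_sign (tk p) = Some b ->
  exec other_clauses_loop (cfg p (cl p).+1 [:: p] (its ++ pairs p (cl p - p)))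
    (cfg p K [:: p] (its ++ pairs p (K - p.+1)))
    (K * (emit_cost + 4 * K + 25)).+1.
Proof.
move=> hp; have [c1 c2 c3 c4] := clP hp.
have := @exec_loop _ _ (fun r : reads 4 aux => isSome (r iB))
  (Seq (If complementary compare_variables (skip aux)) (goB MoveRight))
  (fun i => cfg p ((cl p).+1 + i) [:: p] (its ++ pairs p (cl p - p + i)))
  (K - (cl p).+1) (emit_cost + 4 * K + 22).
rewrite subnKC // !addn0 (_ : cl p - p + _ = K - p.+1); last by lia.
move=> h; apply: exec_leq _ (h _ _); last by rewrite /cfg scan_st read_tok ltnn.
  by rewrite ltnS leq_mul //; lia.
move=> i hi; rewrite {1}/cfg scan_st read_tok (_ : _ + i < K); last by lia.
split=> //.
have -> : emit_cost + 4 * K + 22 = (emit_cost + 4 * K + 20).+1 + 1 by lia.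
rewrite !(addnS _ i); apply: exec_Seq; last by apply: exec_go_right; lia.
apply: exec_If; rewrite /complementary token_A ?token_B /=; try lia.
rewrite pairsS /pair_value (_ : p.+1 + (cl p - p + i) = (cl p).+1 + i); last by lia.
rewrite ltnNge (_ : cl p <= _) /=; last by lia.
rewrite (_ : _ == cl p = false); last by apply/eqP; lia.
rewrite /conflict hp; case e: (lit_sign _) => [b'|] /=; last first.
  by rewrite cats0; apply: exec_leq _ (@exec_skip _ _); lia.
case: eqP => [_|_] /=; first by rewrite cats0; apply: exec_leq _ (@exec_skip _ _); lia.
have {}h := @exec_compare_variables p ((cl p).+1 + i) b b' _ _ hp e.
have {}h its' : exec compare_variables _ _ _ := h its' (ltn_addr _ (leqW c1)).
move: (h (its ++ pairs p (cl p - p + i))).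
by case: (_ == _); rewrite /= ?cats0 // catA cats1.
Qed.

Definition pairs_cost := 3 * (K + 1) * (emit_cost + 4 * K + 30).

Lemma exec_list_pairs p b its :
  lit_sign (tk p) = Some b ->
  exec list_pairs (cfg p p [:: p] its)
    (cfg p p [:: p] (its ++ pairs p (K - p.+1))) pairs_cost.
Proof.
move=> hp; have [c1 c2 c3 c4] := clP hp.
apply: (@exec_leq _ _ _ _ _ (1 + ((K * (emit_cost + 5)).+1 + (emit_cost + 1 +
  (1 + ((K * (emit_cost + 4 * K + 25)).+1 + (2 * K + 2))))))).
  by rewrite /pairs_cost; nia.
apply: exec_Seq; first by apply: exec_go_right; lia.
apply: exec_Seq; first exact: exec_same_clause_loop hp.
apply: exec_Seq.
  by apply: exec_emit_pair => // i hi; rewrite inE; lia.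
apply: exec_Seq; first exact: exec_go_right.
apply: exec_Seq; last first.
  apply: (@exec_to_last_mark _ K); rewrite ?inE ?eqxx //; first by lia.
  by move=> i hi; rewrite inE; lia.
(* The item just emitted for the clause end is the next entry of [pairs]. *)
have -> : rcons (its ++ pairs p (cl p - p.+1)) ([:: cl p; p], 1) =
    its ++ pairs p (cl p - p).
  rewrite (_ : cl p - p = (cl p - p.+1).+1); last by lia.
  rewrite pairsS subnKC // /pair_value ltnn eqxx /=.
  by rewrite -cats1 catA.
exact: exec_other_clauses_loop hp.
Qed.

Lemma exec_emit_clause (s : seq 'I_4) p its :
  p < K ->
  exec (emit_clause s) (cfg p p [::] its)
    (cfg p p [::] (its ++ if tk p is inr (Some n)
       then if n \in s then [:: ([:: p], nat_of_ord n)] else [::] else [::]))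
    (emit_cost + 1 + size s).
Proof.
move=> hp; elim: s => [|n s IH] /=.
  rewrite (_ : (if tk p is inr (Some _) then _ else _) = [::]).
    by rewrite cats0; apply: exec_leq _ (@exec_skip _ _); lia.
  by case: (tk p) => // -[].
rewrite addnS; apply: exec_If; rewrite token_A //.
case: eqP => [[->]|ne].
  rewrite /= inE eqxx cats1; apply: exec_leq; last first.
    by apply: exec_emit_pair => //; exact: ltn_trans (ltn_ord n) _.
  by lia.
case e : (tk p) IH ne => [|[m|]] //= IH ne.
by rewrite inE (_ : m == n = false) //; apply/eqP => emn; apply: ne; rewrite emn.
Qed.

Lemma exec_list_positions its :
  exec list_positions (cfg 0 0 [::] its)
    (cfg K K [::] (its ++ flatten [seq position_items p | p <- iota 0 K]))
    (K * (pairs_cost + emit_cost + 20)).+1.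
Proof.
have := @exec_loop _ _ (fun r : reads 4 aux => isSome (r iA)) list_position
  (fun i => cfg i i [::] (its ++ flatten [seq position_items p | p <- iota 0 i]))
  K (pairs_cost + emit_cost + 10).
rewrite cats0 => h; apply: exec_leq _ (h _ _).
- by rewrite ltnS leq_mul //; lia.
- move=> p hp; rewrite {1}/cfg scan_st read_tok hp; split=> //.
  apply: (@exec_leq _ _ _ _ _ ((pairs_cost + emit_cost + 8).+1 + 1)); first by lia.
  apply: exec_Seq; last exact: exec_both_right.
  rewrite iota_rcons map_rcons flatten_rcons add0n catA.
  apply: exec_If; rewrite /is_literal token_A //=.
  case e: (lit_sign (tk p)) => [b|] /=.
    have -> : position_items p = ([:: p], 1) :: pairs p (K - p.+1).
      by rewrite /position_items; case: (tk p) e => [[]|].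
    rewrite -cat_rcons.
    apply: (@exec_leq _ _ _ _ _ (emit_cost + (pairs_cost + 1))); first by lia.
    apply: exec_Seq; first exact: exec_emit.
    apply: exec_Seq; first exact: exec_list_pairs e.
    exact: exec_unmark.
  have -> : position_items p = if tk p is inr (Some n) then
      if n \in enum 'I_4 then [:: ([:: p], nat_of_ord n)] else [::] else [::].
    by rewrite /position_items; case: (tk p) e => [[]|[n|]] //=; rewrite mem_enum.
  apply: exec_leq; last exact: exec_emit_clause.
  by rewrite size_enum_ord; lia.
- by rewrite /cfg scan_st read_tok ltnn.
Qed.

End Pairs.

(** * Tokens and the binary counter *)

(** The two bits separate four contexts: before the outer bracket, between clauses, between the
    literals of a clause, inside a number. The counter advances at the bracket that opens a number
    and goes into the token at the bracket that closes the clause. *)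
Definition tokenize1 (q : flag) (s : symbol) : token * flag :=
  let: (in_clause, in_inner, n) := q in
  match in_clause, in_inner, s with
  | false, false, _ => (Dummy, (false, true, n))
  | false, true, inr false => (Dummy, (true, false, ord0))
  | false, true, _ => (Dummy, q)
  | true, false, inl b => (Lit b, q)
  | true, false, inr false => (Dummy, (true, true, inord n.+1))
  | true, false, inr true => (Cls n, (false, true, n))
  | true, true, inl b => (Dig b, q)
  | true, true, _ => (Dummy, (true, false, n))
  end.

Fixpoint tokenize (q : flag) (w : word) : seq token :=
  if w is s :: w' then (tokenize1 q s).1 :: tokenize (tokenize1 q s).2 w'
  else [::].

Definition flag_after (q : flag) (w : word) : flag :=
  foldl (fun q s => (tokenize1 q s).2) q w.

Lemma size_tokenize q w : size (tokenize q w) = size w.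
Proof. by elim: w q => //= s w IH q; rewrite IH. Qed.

Lemma tokenize_cat q w w' :
  tokenize q (w ++ w') = tokenize q w ++ tokenize (flag_after q w) w'.
Proof. by elim: w q => //= s w IH q; rewrite IH. Qed.

Lemma flag_after_cat q w w' :
  flag_after q (w ++ w') = flag_after (flag_after q w) w'.
Proof. by rewrite /flag_after foldl_cat. Qed.

Definition tokenize_loop : cmd 4 aux :=
  While (fun r => isSome (r iA)) (Do (fun r =>
    if (r iA, r iF) is (Some (inl s), Some (inr (inr q))) then
      let: (t, q') := tokenize1 q s in
      [:: put (marked t false); put (marked t false); keep aux;
          (Some (inr (inr q')), Stay); keep aux]
    else [::])).

Definition flag_tape (q : flag) : tape aux :=
  Tape [::] [:: Some (inr (inr q))].

Definition unmarked (ts : seq token) : seq (cell aux) :=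
  [seq Some (marked t false) | t <- ts].

Lemma exec_tokenize_loop w la lb q t o :
  exec tokenize_loop
    (st (Tape la [seq Some (inl s) | s <- w]) (Tape lb [::]) t (flag_tape q) o)
    (st (Tape (rev (unmarked (tokenize q w)) ++ la) [::])
        (Tape (rev (unmarked (tokenize q w)) ++ lb) [::]) t
        (flag_tape (flag_after q w)) o)
    (2 * size w + 1).
Proof.
elim: w la lb q => [|s w IH] la lb q.
  by apply: exec_While0; rewrite scan_st.
rewrite (_ : 2 * size (s :: w) + 1 = (1 + (2 * size w + 1)).+1); last by rewrite /=; lia.
apply: (@exec_WhileS _ _ _ _ _ (st
    (Tape (Some (marked (tokenize1 q s).1 false) :: la) [seq Some (inl s) | s <- w])
    (Tape (Some (marked (tokenize1 q s).1 false) :: lb) [::]) t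
    (flag_tape (tokenize1 q s).2) o)); first by rewrite scan_st.
  apply: exec_Do_st; rewrite !scan_st /=.
  by case: (tokenize1 q s).
by rewrite /unmarked /= rev_cons !cat_rcons; apply: IH.
Qed.

(** * Binary counter on the output tape *)

(** Carry propagation, least significant digit first: the initial run of ones becomes zeros and the
    digit after it, possibly a new one, becomes one. *)
Definition binc (s : seq bool) : seq bool :=
  nseq (find negb s) false ++ true :: drop (find negb s).+1 s.

Lemma binary_pos_succ p : binary_pos (Pos.succ p) = binc (binary_pos p).
Proof.
by elim: p => [p IH|p IH|] //=; rewrite ?IH // /binc /= drop0.
Qed.

Lemma binaryS k : binary k.+1 = binc (binary k).
Proof.
rewrite -[k]bin_of_natK; case: (bin_of_nat k) => [|p] //.
have -> : (nat_of_bin (Npos p)).+1 = nat_of_bin (Npos (Pos.succ p)).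
  by rewrite /= nat_of_succ_pos.
by rewrite /binary !nat_of_binK binary_pos_succ.
Qed.

Lemma size_binc s : size (binc s) <= (size s).+1.
Proof.
rewrite size_cat size_nseq /= size_drop.
by have := find_size negb s; lia.
Qed.

Lemma size_binary k : size (binary k) <= k.
Proof.
elim: k => // k IH; rewrite binaryS; apply: leq_trans (size_binc _) _.
by rewrite ltnS.
Qed.

Definition digits_word (s : seq bool) : word := Open :: map Bit s.
Definition digits_tape (q : nat) (s : seq bool) : tape aux :=
  at_pos q (map inl (digits_word s)).

Lemma read_digits q s : read (digits_tape q s) =
  if size s < q then None else Some (inl (nth Open (digits_word s) q)).
Proof.
have sD : size (map (@inl _ aux) (digits_word s)) = (size s).+1.
  by rewrite size_map /= size_map.
rewrite /digits_tape; case: ltnP => h; first by rewrite read_at_end ?sD.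
rewrite (read_at_posE (inl Open)) ?sD // (nth_map Open) //.
by rewrite -(size_map (@inl _ aux)) sD.
Qed.

(** The counter is kept at the front of the output, where the code of K belongs; the bracket that
    opens this code stops the way back. *)
Definition increment : cmd 4 aux :=
  Seq (While (fun r => r iO == Some (inl (Bit true)))
         (Op iO (fun=> put (inl (Bit false)))))
 (Seq (Op iO (fun=> (Some (inl (Bit true)), Stay)))
 (Seq (While (fun r => r iO != Some (inl Open)) (Op iO (fun=> go aux MoveLeft)))
      (Op iO (fun=> go aux MoveRight)))).

Lemma write_at_end (L : seq (symbol + aux)) a :
  write (Some a) (at_pos (size L) L) = at_pos (size L) (rcons L a).
Proof.
rewrite /write /at_pos drop_size take_size -cats1 take_size_cat //.
by rewrite drop_size_cat.
Qed.

(** The case [i = size s] appends a new most significant digit. *)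
Lemma write_digit i s b : i <= size s ->
  write (Some (inl (Bit b))) (digits_tape i.+1 s) =
  digits_tape i.+1 (take i s ++ b :: drop i.+1 s).
Proof.
rewrite /digits_tape leq_eqVlt => /orP[/eqP->|h].
  have {1}-> : (size s).+1 = size (map (@inl _ aux) (digits_word s)).
    by rewrite /= !size_map.
  rewrite write_at_end /= !size_map take_size drop_oversize //.
  by rewrite cats1 !map_rcons.
rewrite (write_at_pos (inl Open)) ?size_map //= ?size_map //; congr (at_pos _ (_ :: _)).
rewrite map_cat map_cat /= (set_nthE) !size_map h.
by rewrite !map_take !map_drop.
Qed.

Lemma right_digits q s : q <= size s ->
  shift MoveRight (digits_tape q s) = digits_tape q.+1 s.
Proof. by move=> h; apply: right_at_pos; rewrite /= !size_map. Qed.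

Lemma left_digits q s : q <= size s ->
  shift MoveLeft (digits_tape q.+1 s) = digits_tape q s.
Proof. by move=> h; apply: left_at_pos; rewrite /= !size_map. Qed.

Lemma nth_digits s i : i < size s -> nth Open (digits_word s) i.+1 = Bit (nth false s i).
Proof. by move=> h; rewrite /= (nth_map false). Qed.

Lemma drop_nseq_cat i (s : seq bool) :
  drop i.+1 (nseq i false ++ drop i s) = drop i.+1 s.
Proof.
by rewrite drop_cat size_nseq ltnNge leqnSn subSnn drop_drop add1n.
Qed.

Lemma exec_increment s (T : store 4 aux) :
  T iO = digits_tape 1 s ->
  exec increment T (upd T iO (digits_tape 1 (binc s))) (4 * size s + 8).
Proof.
move=> TO; set j := find negb s.
have hj : j <= size s by exact: find_size.
have hB : size (binc s) = (j + (size s - j.+1)).+1.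
  by rewrite size_cat size_nseq /= size_drop addnS.
apply: (@exec_leq _ _ _ _ _ ((j * 1.+1).+1 + (1 + ((j.+1 * 1.+1).+1 + 1)))); first by lia.
(* After [i] rounds of the carry, the first [i] digits are zeros and the others unchanged. *)
have := @exec_loop _ _ (fun r : reads 4 aux => r iO == Some (inl (Bit true)))
  (Op iO (fun=> put (inl (Bit false))))
  (fun i => upd T iO (digits_tape i.+1 (nseq i false ++ drop i s))) j 1.
rewrite /= drop0 -TO upd_id => h.
apply: exec_Seq; first apply: h.
- move=> i hi; have hs : i < size s by lia.
  have ei : size (nseq i false ++ drop i s) = size s.
    by rewrite size_cat size_nseq size_drop; lia.
  split.
    rewrite scan_upd read_digits ei ltnNge hs nth_digits ?ei //.
    rewrite nth_cat size_nseq ltnn subnn nth_drop addn0.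
    by have /(before_find false) := hi; move=> /negbFE ->.
  rewrite -[X in exec _ _ X](upd_upd _ _ (digits_tape i.+1 (nseq i false ++ drop i s))).
  apply: exec_Op_eq; rewrite upd_same.
  rewrite -[LHS]/(shift MoveRight (write (Some (inl (Bit false)))
    (digits_tape i.+1 (nseq i false ++ drop i s)))).
  rewrite write_digit ?ei; last by lia.
  rewrite take_size_cat ?size_nseq // drop_nseq_cat right_digits; last first.
    by rewrite size_cat size_nseq /= size_drop; lia.
  congr digits_tape; move: (drop i.+1 s) => r.
  by elim: (i) => //= k ->.
- have ei : size (nseq j false ++ drop j s) = size s.
    by rewrite size_cat size_nseq size_drop; lia.
  rewrite scan_upd read_digits ei; case: ltnP => // hs.
  rewrite nth_digits ?ei // nth_cat size_nseq ltnn subnn nth_drop addn0.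
  have : has negb s by rewrite has_find.
  by move=> /(nth_find false); rewrite -/j => /negbTE ->.
apply: (@exec_Seq _ _ _ _ _ (upd T iO (digits_tape j.+1 (binc s)))).
  rewrite -[X in exec _ _ X](upd_upd _ _ (digits_tape j.+1 (nseq j false ++ drop j s))).
  apply: exec_Op_eq; rewrite upd_same.
  rewrite -[LHS]/(write (Some (inl (Bit true)))
    (digits_tape j.+1 (nseq j false ++ drop j s))).
  rewrite write_digit; last by rewrite size_cat size_nseq size_drop; lia.
  by rewrite take_size_cat ?size_nseq // drop_nseq_cat.
apply: (@exec_Seq _ _ _ _ _ (upd T iO (digits_tape 0 (binc s)))); last first.
  rewrite -[X in exec _ _ X](upd_upd _ _ (digits_tape 0 (binc s))).
  by apply: exec_Op_eq; rewrite upd_same; exact: right_digits.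
have := @exec_loop _ _ (fun r : reads 4 aux => r iO != Some (inl Open))
  (Op iO (fun=> go aux MoveLeft))
  (fun i => upd T iO (digits_tape (j.+1 - i) (binc s))) j.+1 1.
rewrite subn0 subnn => {}h; apply: h; last by rewrite scan_upd.
move=> i hi; have -> : j.+1 - i = (j - i).+1 by lia.
split.
  rewrite scan_upd read_digits hB nth_digits; last by rewrite hB; lia.
  by case: ltnP => //; lia.
rewrite -[X in exec _ _ X](upd_upd _ _ (digits_tape (j - i).+1 (binc s))).
apply: exec_Op_eq; rewrite upd_same subSS; apply: left_digits.
by rewrite hB; lia.
Qed.

(** * The whole program *)

Definition count_loop : cmd 4 aux :=
  While (fun r => isSome (r iB)) (Seq increment (goB MoveRight)).

Definition to_end_O : cmd 4 aux :=
  While (fun r => isSome (r iO)) (Op iO (fun=> go aux MoveRight)).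

Definition copy_thetas : cmd 4 aux :=
  While (fun r => isSome (r iT)) (Do (fun r =>
    [:: keep aux; keep aux; go aux MoveRight; keep aux;
        if r iT is Some (inl s) then put (inl s) else keep aux])).

Definition write_query : cmd 4 aux :=
  While (fun r => isSome (r iB)) (Do (fun r =>
    [:: keep aux; go aux MoveRight; keep aux; keep aux;
        put (inl (Bit (is_clause (r iB))))])).

Definition start_flag : flag := (false, false, ord0).

(** In the code of an instance the whole family comes before the frequencies, although one pass
    produces both; hence the frequencies wait on tape T. The last rewind is needed because the
    output is read from the head rightwards. *)
Definition program : cmd 4 aux :=
  Seq (Op iF (fun=> (Some (inr (inr start_flag)), Stay)))
 (Seq tokenize_loop
 (Seq (rewind aux iA)
 (Seq (rewind aux iB)
 (Seq (puts aux iO [:: Open])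
 (Seq count_loop
 (Seq to_end_O
 (Seq (puts aux iO [:: Close; Open])
 (Seq (puts aux iT [:: Open])
 (Seq (list_item 6)
 (Seq (rewind aux iB)
 (Seq list_positions
 (Seq (puts aux iO [:: Close])
 (Seq (puts aux iT [:: Close])
 (Seq (rewind aux iT)
 (Seq copy_thetas
 (Seq (rewind aux iB)
 (Seq (puts aux iO [:: Open])
 (Seq write_query
 (Seq (puts aux iO (Close :: enc_rat (theta_of 0)))
      (rewind aux iO)))))))))))))))))))).

Lemma exec_to_end_O s (a b t f : tape aux) :
  exec to_end_O (st a b t f (digits_tape 1 s))
    (st a b t f (written aux (digits_word s))) (2 * size s + 1).
Proof.
have := @exec_loop _ _ (fun r : reads 4 aux => isSome (r iO))
  (Op iO (fun=> go aux MoveRight)) (fun i => st a b t f (digits_tape i.+1 s))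
  (size s) 1.
rewrite (_ : digits_tape (size s).+1 s = written aux (digits_word s)); last first.
  by rewrite /written /= size_map.
rewrite (_ : (size s * 2).+1 = 2 * size s + 1); last by lia.
apply=> [i hi|]; last by rewrite scan_st /written read_at_end // size_map.
rewrite scan_st read_digits ltnNge hi; split=> //.
rewrite -[X in exec _ _ X](upd_O _ _ _ _ (digits_tape i.+1 s)).
by apply: exec_Op_eq; rewrite ffunE; exact: right_digits.
Qed.

Lemma exec_copy_thetas w v (a b f : tape aux) :
  exec copy_thetas (st a b (at_pos 0 (map inl w)) f (written aux v))
    (st a b (written aux w) f (written aux (v ++ w))) (2 * size w + 1).
Proof.
have := @exec_loop _ _ (fun r : reads 4 aux => isSome (r iT)) (Do (fun r =>
    [:: keep aux; keep aux; go aux MoveRight; keep aux;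
        if r iT is Some (inl s) then put (inl s) else keep aux]))
  (fun i => st a b (at_pos i (map inl w)) f (written aux (v ++ take i w)))
  (size w) 1.
rewrite take0 cats0 take_size (_ : (size w * 2).+1 = 2 * size w + 1); last by lia.
apply=> [i hi|]; last by rewrite scan_st read_at_end // size_map.
have e : read (at_pos i (map (@inl _ aux) w)) = Some (inl (nth Open w i)).
  by rewrite (read_at_posE (inl Open)) ?size_map // (nth_map Open).
rewrite scan_st e; split=> //.
rewrite (take_nth Open hi) -rcons_cat -append_written.
apply: exec_Do_st; rewrite /= scan_st e; do 2 split=> //.
by split; first by apply: right_at_pos; rewrite size_map.
Qed.

Section Program.

Variables (w : word) (bits : nat -> seq bool) (cl : nat -> nat).
Let ts := tokenize start_flag w.
Let K := size w.

Hypothesis literalP : literal_layout K ts bits.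
Hypothesis clP : clause_layout K ts cl.

Local Notation tok_tape := (tok_tape K ts).
Local Notation tc := theta_cost.

Lemma tokenized_tape :
  Tape (rev (unmarked ts)) [::] = tok_tape K [::].
Proof.
have sK : size (marks K ts [::]) = K by exact: size_marks.
have e : marks K ts [::] = [seq marked t false | t <- ts].
  apply: (@eq_from_nth _ (marked Dummy false)).
    by rewrite sK size_map size_tokenize.
  move=> i; rewrite sK => hi.
  by rewrite nth_marks // (nth_map Dummy) ?size_tokenize.
rewrite /tok_tape /at_pos take_oversize ?drop_oversize ?sK //.
by rewrite e /unmarked -map_comp.
Qed.

Lemma exec_count_loop (a t f : tape aux) :
  exec count_loop (st a (tok_tape 0 [::]) t f (digits_tape 1 [::]))
    (st a (tok_tape K [::]) t f (digits_tape 1 (binary K))) (K * (4 * K + 10)).+1.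
Proof.
have := @exec_loop _ _ (fun r : reads 4 aux => isSome (r iB))
  (Seq increment (goB MoveRight))
  (fun i => st a (tok_tape i [::]) t f (digits_tape 1 (binary i))) K (4 * K + 9).
rewrite -addnS; apply; last by rewrite scan_st read_tok ltnn.
move=> i hi; rewrite scan_st read_tok hi; split=> //.
apply: (@exec_leq _ _ _ _ _ ((4 * size (binary i) + 8) + 1)).
  by have := size_binary i; lia.
apply: exec_Seq; first by apply: exec_increment; rewrite ffunE.
rewrite upd_O -binaryS -[X in exec _ _ X](upd_B _ (tok_tape i [::])).
by apply: exec_Op_eq; rewrite ffunE; exact: right_tok.
Qed.

Lemma exec_write_query (a t f : tape aux) v :
  exec write_query (st a (tok_tape 0 [::]) t f (written aux v))
    (st a (tok_tape K [::]) t f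
       (written aux (v ++ map Bit [seq is_cls (nth Dummy ts i) | i <- iota 0 K])))
    (2 * K + 1).
Proof.
have := @exec_loop _ _ (fun r : reads 4 aux => isSome (r iB)) (Do (fun r =>
    [:: keep aux; go aux MoveRight; keep aux; keep aux;
        put (inl (Bit (is_clause (r iB))))]))
  (fun k => st a (tok_tape k [::]) t f (written aux
    (v ++ map Bit [seq is_cls (nth Dummy ts i) | i <- iota 0 k]))) K 1.
rewrite cats0 (_ : (K * 2).+1 = 2 * K + 1); last by lia.
apply; last by rewrite scan_st read_tok ltnn.
move=> i hi; rewrite scan_st read_tok hi; split => //.
rewrite iota_rcons !map_rcons -rcons_cat -append_written.
apply: exec_Do_st; rewrite /= scan_st read_tok hi.
by split=> //; split; first exact: right_tok.
Qed.

Definition items : seq item :=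
  ([::], 6) :: flatten [seq position_items K ts bits cl p | p <- iota 0 K].

Definition output_word : word :=
  ((((family_word K (enc_nat K) items ++ [:: Close]) ++ (theta_word items ++ [:: Close]))
   ++ [:: Open]) ++ map Bit [seq is_cls (nth Dummy ts i) | i <- iota 0 K])
   ++ Close :: enc_rat (theta_of 0).

Definition program_cost := 4 * (size (theta_word items)).+1 + 2 * size output_word +
  K * (pairs_cost K + emit_cost K + 20) + K * (4 * K + 10) + 20 * K + 2 * tc + 60.

Lemma exec_program : exists T,
  exec program (st (Tape [::] [seq Some (inl s) | s <- w]) (Tape [::] [::])
    (written aux [::]) (Tape [::] [::]) (written aux [::])) T program_cost /\
  T iO = at_pos 0 (map inl output_word).
Proof.
have hc : size (enc_rat (theta_of 0)) <= tc.
  exact: (@leq_bigmax _ (fun n : 'I_7 => size (enc_rat (theta_of n))) ord0).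
have hb := size_binary K.
eexists; split.
  apply: (@exec_leq _ _ _ _ _ (1 + (2 * K + 1 + (2 * K + 3 + (2 * K + 3 + (2 +
   ((K * (4 * K + 10)).+1 + (2 * size (binary K) + 1 + (3 + (2 +
   (tc + 4 * K + 10 + (2 * K + 3 + ((K * (pairs_cost K + emit_cost K + 20)).+1 +
   (2 + (2 + (2 * (size (theta_word items)).+1 + 3 +
   (2 * (size (theta_word items)).+1 + 1 + (2 * K + 3 + (2 + (2 * K + 1 +
   ((size (enc_rat (theta_of 0))).+2 + (2 * size output_word + 3)))))))))))))))))))))).
    by rewrite /program_cost; lia.
  apply: (@exec_Seq _ _ _ _ _ (st (Tape [::] [seq Some (inl s) | s <- w])
     (Tape [::] [::]) (written aux [::]) (flag_tape start_flag) (written aux [::]))).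
    rewrite -[X in exec _ _ X](upd_F _ _ _ (Tape [::] [::])).
    by apply: exec_Op_eq; rewrite ffunE.
  apply: exec_Seq; first exact: exec_tokenize_loop.
  rewrite !cats0 tokenized_tape.
  apply: exec_Seq; first by apply: exec_rewind_A; rewrite size_marks.
  apply: exec_Seq; first by apply: exec_rewind_B; rewrite size_marks.
  apply: exec_Seq; first exact: (@exec_write_O aux [::] _ _ _ _ _).
  apply: exec_Seq; first exact: exec_count_loop.
  apply: exec_Seq; first exact: exec_to_end_O.
  apply: exec_Seq; first exact: exec_write_O.
  apply: exec_Seq; first exact: (@exec_write_T aux [::] _ _ _ _ _).
  rewrite (_ : digits_word (binary K) ++ [:: Close; Open] =
    family_word K (enc_nat K) [::]); last first.
    by rewrite /family_word /enc_nat enc_bitsE /= -catA.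
  (* No mark is set yet, so this lists the empty itemset, with frequency 6/6. *)
  apply: exec_Seq; first exact: (@exec_list_item _ _ _ _ _ K [::] [::] 6).
  apply: exec_Seq; first by apply: exec_rewind_B; rewrite size_marks.
  apply: exec_Seq; first exact: (@exec_list_positions K ts bits cl literalP clP _ _ [:: ([::], 6)]).
  apply: exec_Seq; first exact: exec_write_O.
  apply: exec_Seq; first exact: exec_write_T.
  rewrite cat1s -/items.
  apply: exec_Seq.
    by rewrite /written size_cat addn1; apply: exec_rewind_T; rewrite size_map size_cat addn1.
  apply: exec_Seq.
    by have := exec_copy_thetas; rewrite -[(size (theta_word items)).+1]addn1 -(size_cat _ [:: Close]); apply.
  apply: exec_Seq; first by apply: exec_rewind_B; rewrite size_marks.
  apply: exec_Seq; first exact: exec_write_O.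
  apply: exec_Seq; first exact: exec_write_query.
  apply: exec_Seq; first exact: exec_write_O.
  by rewrite -/output_word; apply: exec_rewind_O; rewrite size_map.
by rewrite ffunE.
Qed.

End Program.

(** * Clauses and literals as positions of the input *)

(* What a position of the input stands for: [occ_lit j k l] for the k-th
   literal l of clause j (placed at the sign of l), [occ_cls j n] for clause j,
   of n literals (placed at its end), and None for the other positions. *)
Definition occurrence := option ((nat * nat * literal) + (nat * nat)).
Definition occ_lit j k (l : literal) : occurrence := Some (inl (j, k, l)).
Definition occ_cls j n : occurrence := Some (inr (j, n)).

(** Meaning and token of each position are built together, so that the two sequences are aligned by
    construction. *)
Definition annotated := (occurrence * token)%type.

Definition annotate_literal j k (l : literal) : seq annotated :=
  (occ_lit j k l, Lit l.1) :: (None, Dummy) ::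
  [seq (None, Dig b) | b <- binary l.2] ++ [:: (None, Dummy)].

Definition literal0 : literal := (true, 0).

Definition annotate_literals j (C : clause) : seq annotated :=
  flatten [seq annotate_literal j k (nth literal0 C k) | k <- iota 0 (size C)].

Definition annotate_clause j (C : clause) : seq annotated :=
  (None, Dummy) :: annotate_literals j C ++
  [:: (occ_cls j (size C), Cls (inord (size C)))].

Definition annotate_clauses (phi : cnf) : seq annotated :=
  flatten [seq annotate_clause j (nth [::] phi j) | j <- iota 0 (size phi)].

Definition annotate (phi : cnf) : seq annotated :=
  (None, Dummy) :: annotate_clauses phi ++ [:: (None, Dummy)].

Lemma map_nth_iota T T' (f : T -> T') x0 (s : seq T) :
  [seq f (nth x0 s i) | i <- iota 0 (size s)] = map f s.
Proof. by rewrite (map_comp f) map_nth_iota0 // take_size. Qed.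

Lemma tokenize_digits n s :
  (tokenize (true, true, n) (map Bit s) = map Dig s) *
  (flag_after (true, true, n) (map Bit s) = (true, true, n)).
Proof. by elim: s => //= b s [-> IH]; split=> //; rewrite -[RHS]IH. Qed.

Lemma tokenize_literal n l :
  (tokenize (true, false, n) (enc_literal l) =
     Lit l.1 :: Dummy :: map Dig (binary l.2) ++ [:: Dummy]) *
  (flag_after (true, false, n) (enc_literal l) = (true, false, inord n.+1)).
Proof.
rewrite /enc_literal /enc_nat enc_bitsE /= tokenize_cat.
rewrite (tokenize_digits _ (binary l.2)).1; split.
  by rewrite (tokenize_digits _ (binary l.2)).2.
rewrite /flag_after /= foldl_cat -[foldl _ _ (map Bit _)]/(flag_after _ _).
by rewrite (tokenize_digits _ (binary l.2)).2.
Qed.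

Lemma flatten_cons T (x : seq T) s : flatten (x :: s) = x ++ flatten s.
Proof. by []. Qed.

(** The bound keeps the counter inside ['I_4]; beyond it [inord] would fall back to 0. *)
Lemma tokenize_literals (C : clause) c : c + size C <= 3 ->
  (tokenize (true, false, inord c) (flatten (map enc_literal C)) =
    flatten [seq Lit l.1 :: Dummy :: map Dig (binary l.2) ++ [:: Dummy] | l <- C]) *
  (flag_after (true, false, inord c) (flatten (map enc_literal C)) =
    (true, false, inord (c + size C))).
Proof.
elim: C c => [|l C IH] c h; first by rewrite addn0.
rewrite !map_cons !flatten_cons tokenize_cat flag_after_cat !(tokenize_literal _ l).
have -> : inord (inord c : 'I_4).+1 = inord c.+1 :> 'I_4.
  by rewrite inordK //; move: h; rewrite /=; lia.
have h' : c.+1 + size C <= 3 by rewrite addSnnS.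
by rewrite !(IH _ h') addSnnS.
Qed.

Lemma tokenize_clause n (C : clause) : size C <= 3 ->
  (tokenize (false, true, n) (enc_seq enc_literal C) =
    Dummy :: flatten [seq Lit l.1 :: Dummy :: map Dig (binary l.2) ++ [:: Dummy] | l <- C]
    ++ [:: Cls (inord (size C))]) *
  (flag_after (false, true, n) (enc_seq enc_literal C) = (false, true, inord (size C))).
Proof.
move=> h; have e0 : ord0 = inord 0 :> 'I_4 by apply: val_inj; rewrite /= inordK.
have [e1 e2] := @tokenize_literals C 0 h.
rewrite /enc_seq -[tokenize _ _]/(Dummy :: tokenize (true, false, ord0) _).
rewrite -[flag_after _ _]/(flag_after (true, false, ord0) _).
by rewrite e0 tokenize_cat flag_after_cat e1 e2.
Qed.

Lemma tokens_annotate_clause j C : map snd (annotate_clause j C) =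
  Dummy :: flatten [seq Lit l.1 :: Dummy :: map Dig (binary l.2) ++ [:: Dummy] | l <- C]
    ++ [:: Cls (inord (size C))].
Proof.
rewrite /= map_cat /annotate_literals map_flatten -map_comp /=.
rewrite -(map_nth_iota _ literal0 C); congr (_ :: flatten _ ++ _).
by apply: eq_map => k; rewrite /= map_cat -map_comp.
Qed.

Lemma tokenize_annotate phi : (forall C, C \in phi -> size C <= 3) ->
  tokenize start_flag (enc_cnf phi) = map snd (annotate phi).
Proof.
move=> h; rewrite /enc_cnf /enc_seq -/(enc_seq enc_literal) /= tokenize_cat map_cat.
rewrite /annotate_clauses map_flatten -map_comp.
rewrite -[RHS]/(Dummy :: (_ ++ [:: Dummy])).
(* Tokens do not depend on the number of the clause; setting it to 0 opens the way to induction on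
   [phi]. *)
have -> : [seq (map snd \o (fun j => annotate_clause j (nth [::] phi j))) j
           | j <- iota 0 (size phi)] = [seq map snd (annotate_clause 0 C) | C <- phi].
  rewrite -(map_nth_iota (fun C => map snd (annotate_clause 0 C)) [::] phi).
  apply: eq_map => j; rewrite -[LHS]/(map snd (annotate_clause j _)).
  by rewrite -[RHS]/(map snd (annotate_clause 0 _)) !tokens_annotate_clause.
set n := ord0; suff [-> [n' ->]] : tokenize (false, true, n) (flatten (map (enc_seq enc_literal) phi)) =
    flatten [seq map snd (annotate_clause 0 C) | C <- phi] /\
    exists n', flag_after (false, true, n) (flatten (map (enc_seq enc_literal) phi)) =
    (false, true, n') by [].
elim: phi n h => [|C phi IH] n h; first by split=> //; exists n.
have hC : size C <= 3 by apply: h; rewrite inE eqxx.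
rewrite !map_cons !flatten_cons tokenize_cat flag_after_cat.
rewrite !(tokenize_clause _ hC) -(tokens_annotate_clause 0).
have [-> h2] := IH (inord (size C)) (fun C h' => h C (mem_behead (s := _ :: _) h')).
by split.
Qed.

Lemma size_annotate phi : (forall C, C \in phi -> size C <= 3) ->
  size (annotate phi) = size (enc_cnf phi).
Proof. by move=> /tokenize_annotate h; rewrite -(size_map snd) -h size_tokenize. Qed.

(** * Order of the occurrences in the input *)

(** [None] is related to everything, so the relation is not transitive; the order of the input is
    therefore stated with [pairwise] instead of [sorted]. *)
Definition precedes (x y : occurrence) : bool :=
  match x, y with
  | Some (inl (j, k, _)), Some (inl (j', k', _)) => (j < j') || (j == j') && (k < k')
  | Some (inl (j, _, _)), Some (inr (j', _)) => j <= j'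
  | Some (inr (j, _)), Some (inl (j', _, _)) => j < j'
  | Some (inr (j, _)), Some (inr (j', _)) => j < j'
  | _, _ => true
  end.

Lemma precedes_None x : precedes x None.
Proof. by case: x => [[[[]]|[]]|]. Qed.

Lemma pairwise_flatten_iota (T : eqType) (r : rel T) (f : nat -> seq T) m n :
  (forall i, pairwise r (f i)) ->
  (forall i i' x y, i < i' -> x \in f i -> y \in f i' -> r x y) ->
  pairwise r (flatten [seq f i | i <- iota m n]).
Proof.
move=> h1 h2; elim: n m => //= n IH m; rewrite pairwise_cat h1 IH !andbT.
apply/allrelP => x y hx /flattenP[s /mapP[i]]; rewrite mem_iota => /andP[hi _] ->.
exact: h2 hx.
Qed.

Definition occs (phi : cnf) : seq occurrence := map fst (annotate phi).

Lemma mem_annotate_literal j k l x :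
  x \in map fst (annotate_literal j k l) -> x = occ_lit j k l \/ x = None.
Proof.
rewrite /= !inE => /or3P[/eqP->|/eqP->|]; [by left|by right|].
rewrite map_cat mem_cat -map_comp => /orP[/mapP[b _ ->]|]; first by right.
by rewrite inE => /eqP; right.
Qed.

Lemma mem_annotate_literals j C x : x \in map fst (annotate_literals j C) ->
  (exists2 k, k < size C & x = occ_lit j k (nth literal0 C k)) \/ x = None.
Proof.
rewrite /annotate_literals map_flatten -map_comp => /flattenP[s /mapP[k]].
rewrite mem_iota => /andP[_ hk] -> /mem_annotate_literal[]; last by right.
by left; exists k.
Qed.

Lemma mem_annotate_clause j C x : x \in map fst (annotate_clause j C) ->
  [\/ exists2 k, k < size C & x = occ_lit j k (nth literal0 C k),
      x = occ_cls j (size C) | x = None].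
Proof.
rewrite /= inE map_cat mem_cat => /or3P[/eqP->|/mem_annotate_literals[h|h]|].
- by constructor 3.
- by constructor 1.
- by constructor 3.
- by rewrite inE => /eqP; constructor 2.
Qed.

Lemma mem_occs phi x : x \in occs phi ->
  [\/ exists j k, [/\ j < size phi, k < size (nth [::] phi j) &
        x = occ_lit j k (nth literal0 (nth [::] phi j) k)],
      exists2 j, j < size phi & x = occ_cls j (size (nth [::] phi j)) | x = None].
Proof.
rewrite /occs /= inE map_cat mem_cat => /or3P[/eqP->||]; first by constructor 3.
  rewrite /annotate_clauses map_flatten -map_comp => /flattenP[s /mapP[j]].
  rewrite mem_iota => /andP[_ hj] -> /mem_annotate_clause[[k hk e]|e|e].
  - by constructor 1; exists j, k.
  - by constructor 2; exists j.
  - by constructor 3.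
by rewrite inE => /eqP; constructor 3.
Qed.

Lemma pairwise_literal j k l : pairwise precedes (map fst (annotate_literal j k l)).
Proof.
have -> : map fst (annotate_literal j k l) =
    occ_lit j k l :: nseq (size (binary l.2)).+2 None.
  rewrite /= map_cat -map_comp; congr [:: _, _ & _].
  by elim: (binary l.2) => //= b s ->.
rewrite pairwise_cons; apply/andP; split.
  by apply/allP => x /nseqP[-> _].
by elim: (_.+2) => //= n ->; rewrite andbT; apply/allP.
Qed.

Lemma pairwise_clause j C : pairwise precedes (map fst (annotate_clause j C)).
Proof.
rewrite /annotate_clause map_cons pairwise_cons; apply/andP; split.
  by apply/allP => x _.
rewrite map_cat pairwise_cat /= andbT; apply/andP; split.
  apply/allrelP => x y /mem_annotate_literals[[k _ ->]|->]; last by case: y.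
  by rewrite inE => /eqP ->; rewrite /= leqnn.
rewrite /annotate_literals map_flatten -map_comp.
apply: pairwise_flatten_iota => [k|k k' x y hk]; first exact: pairwise_literal.
move=> /mem_annotate_literal[->|->] /mem_annotate_literal[->|->] //.
by rewrite /= eqxx hk orbT.
Qed.

Lemma pairwise_occs phi : pairwise precedes (occs phi).
Proof.
rewrite /occs /annotate map_cons pairwise_cons; apply/andP; split.
  by apply/allP => x _.
rewrite map_cat pairwise_cat /= andbT; apply/andP; split.
  by apply/allrelP => x y _; rewrite inE => /eqP ->; exact: precedes_None.
rewrite /annotate_clauses map_flatten -map_comp.
apply: pairwise_flatten_iota => [k|k k' x y hk]; first exact: pairwise_clause.
move=> /mem_annotate_clause[[m _ ->]|->|->] /mem_annotate_clause[[m' _ ->]|->|->] //;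
  rewrite /= ?hk //.
exact: ltnW.
Qed.

Definition occ (phi : cnf) p : occurrence := nth None (occs phi) p.

Lemma occ_size phi p x : occ phi p = Some x -> p < size (occs phi).
Proof. by move=> h; rewrite ltnNge; apply/negP => hp; move: h; rewrite /occ nth_default. Qed.

Lemma occ_mem phi p x : occ phi p = Some x -> Some x \in occs phi.
Proof. by move=> h; rewrite -h; apply: mem_nth; apply: occ_size h. Qed.

Lemma occ_precedes phi p q : p < q < size (occs phi) -> precedes (occ phi p) (occ phi q).
Proof.
move=> /andP[pq hq]; move/(pairwiseP None): (pairwise_occs phi); apply => //.
by rewrite inE; apply: ltn_trans hq.
Qed.

Lemma precedes_irr x : x <> None -> precedes x x = false.
Proof. by case: x => [[[[j k] l]|[j n]]|] //= _; rewrite !ltnn ?andbF. Qed.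

(** An occurrence found at two positions would precede itself. *)
Lemma occ_inj phi p q x : occ phi p = Some x -> occ phi q = Some x -> p = q.
Proof.
wlog : p q / p < q => [h hp hq|pq hp hq].
  by case: (ltngtP p q) => // lt; [apply: h|apply/esym/h].
have := @occ_precedes phi p q; rewrite pq (occ_size hq) hp hq precedes_irr //.
by move=> /(_ isT).
Qed.

Definition token_matches (a : annotated) : bool :=
  match a.1 with
  | Some (inl (_, _, l)) => a.2 == Lit l.1
  | Some (inr (_, n)) => a.2 == Cls (inord n)
  | None => (lit_sign a.2 == None) && ~~ is_cls a.2
  end.

Lemma all_token_matches phi : all token_matches (annotate phi).
Proof.
rewrite /= all_cat /= andbT; apply/allP => a /flattenP[s /mapP[j _ ->]].
rewrite inE mem_cat => /or3P[/eqP-> //||]; last first.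
  by rewrite inE => /eqP ->; rewrite /token_matches /=.
move=> /flattenP[s' /mapP[k _ ->]].
rewrite !inE => /or3P[/eqP->|/eqP-> //|]; first by rewrite /token_matches /=.
by rewrite mem_cat => /orP[/mapP[b _ ->] //|]; rewrite inE => /eqP ->.
Qed.

Definition toks (phi : cnf) : seq token := map snd (annotate phi).
Definition tok_at (phi : cnf) p : token := nth Dummy (toks phi) p.

Lemma tok_at_matches phi p : token_matches (occ phi p, tok_at phi p).
Proof.
case: (ltnP p (size (annotate phi))) => h; last first.
  by rewrite /occ /tok_at !nth_default // size_map.
rewrite /occ /tok_at !(nth_map (None, Dummy)) // -surjective_pairing.
exact: (all_nthP _ (all_token_matches phi)).
Qed.

Lemma tok_at_lit phi p j k l : occ phi p = occ_lit j k l -> tok_at phi p = Lit l.1.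
Proof. by move=> e; have := tok_at_matches phi p; rewrite e => /eqP. Qed.

Lemma tok_at_cls phi p j n : occ phi p = occ_cls j n -> tok_at phi p = Cls (inord n).
Proof. by move=> e; have := tok_at_matches phi p; rewrite e => /eqP. Qed.

Lemma lit_sign_tok phi p b : lit_sign (tok_at phi p) = Some b ->
  exists j k l, occ phi p = occ_lit j k l /\ b = l.1.
Proof.
have := tok_at_matches phi p; rewrite /token_matches [_.1]/= [_.2]/=.
case: (occ phi p) => [[[[j k] l]|[j n]]|] /=.
- by move=> /eqP -> [<-]; exists j, k, l.
- by move=> /eqP ->.
- by move=> /andP[/eqP ->].
Qed.

Lemma is_cls_tok phi p : is_cls (tok_at phi p) -> exists j n, occ phi p = occ_cls j n.
Proof.
have := tok_at_matches phi p; rewrite /token_matches [_.1]/= [_.2]/=.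
case: (occ phi p) => [[[[j k] l]|[j n]]|] /=.
- by move=> /eqP ->.
- by exists j, n.
- by move=> /andP[_ /negP h] /h.
Qed.

Lemma flatten_iota_split T (f : nat -> seq T) i n : i < n ->
  flatten [seq f i | i <- iota 0 n] = flatten [seq f i | i <- iota 0 i] ++
    f i ++ flatten [seq f i | i <- iota i.+1 (n - i.+1)].
Proof.
move=> h; rewrite -{1}(subnKC (ltnW h)) iotaD map_cat flatten_cat.
by rewrite (_ : n - i = (n - i.+1).+1); last by lia.
Qed.

Lemma annotate_literal_split phi j k (C := nth [::] phi j) :
  j < size phi -> k < size C ->
  exists u v, annotate phi = u ++ annotate_literal j k (nth literal0 C k) ++ v.
Proof.
move=> hj hk; rewrite /annotate /annotate_clauses (flatten_iota_split _ hj).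
rewrite [annotate_clause j _]/annotate_clause /annotate_literals.
rewrite (flatten_iota_split _ hk) -/C; set a := annotate_literal _ _ _.
set u1 := flatten _; set u2 := flatten _; set v1 := flatten _; set v2 := flatten _.
exists ((None, Dummy) :: u1 ++ (None, Dummy) :: u2).
exists (v1 ++ [:: (occ_cls j (size C), Cls (inord (size C)))] ++ v2 ++ [:: (None, Dummy)]).
by rewrite !(cat_cons, =^~ catA).
Qed.

Lemma annotate_clause_split phi j (C := nth [::] phi j) : j < size phi ->
  exists u v, annotate phi = u ++ (occ_cls j (size C), Cls (inord (size C))) :: v.
Proof.
move=> hj; rewrite /annotate /annotate_clauses (flatten_iota_split _ hj).
rewrite [annotate_clause j _]/annotate_clause -/C.
set u1 := flatten _; set u2 := annotate_literals _ _; set v2 := flatten _.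
exists ((None, Dummy) :: u1 ++ (None, Dummy) :: u2), (v2 ++ [:: (None, Dummy)]).
by rewrite !(cat_cons, =^~ catA).
Qed.

Lemma occ_lit_dom phi p j k l : occ phi p = occ_lit j k l ->
  [/\ j < size phi, k < size (nth [::] phi j) & l = nth literal0 (nth [::] phi j) k].
Proof.
move=> e; have [[j' [k' [hj hk]]]|[j' _]|] // := mem_occs (occ_mem e).
by move=> [-> -> ->].
Qed.

Lemma occ_cls_dom phi p j n : occ phi p = occ_cls j n ->
  j < size phi /\ n = size (nth [::] phi j).
Proof.
move=> e; have [[j' [k' []]]|[j' hj]|] // := mem_occs (occ_mem e).
by move=> [-> ->].
Qed.

Lemma occ_lit_exists phi j k (C := nth [::] phi j) : j < size phi -> k < size C ->
  exists p, occ phi p = occ_lit j k (nth literal0 C k).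
Proof.
move=> hj hk; have [u [v e]] := annotate_literal_split hj hk.
by exists (size u); rewrite /occ /occs e map_cat nth_cat size_map ltnn subnn.
Qed.

Lemma occ_cls_exists phi j : j < size phi ->
  exists p, occ phi p = occ_cls j (size (nth [::] phi j)).
Proof.
move=> hj; have [u [v e]] := annotate_clause_split hj.
by exists (size u); rewrite /occ /occs e map_cat nth_cat size_map ltnn subnn.
Qed.

Lemma occ_lit_split phi p j k l : occ phi p = occ_lit j k l ->
  exists u v, annotate phi = u ++ annotate_literal j k l ++ v /\ size u = p.
Proof.
move=> e; have [hj hk el] := occ_lit_dom e.
have [u [v ea]] := annotate_literal_split hj hk.
(* The splitting places the literal at [size u]; by uniqueness this is [p]. *)
exists u, v; rewrite el; split=> //; apply: (@occ_inj phi _ _ (inl (j, k, l))) => //.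
by rewrite /occ /occs ea map_cat nth_cat size_map ltnn subnn el.
Qed.

Definition digits_at (phi : cnf) p : seq bool :=
  if occ phi p is Some (inl (_, _, l)) then binary l.2 else [::].

Definition clause_end (phi : cnf) p : nat :=
  if occ phi p is Some (inl (j, _, _))
  then index (occ_cls j (size (nth [::] phi j))) (occs phi) else 0.

Lemma toks_literal_layout phi :
  literal_layout (size (annotate phi)) (toks phi) (digits_at phi).
Proof.
move=> p b /lit_sign_tok [j [k [l [e _]]]]; rewrite /digits_at e.
have [u [v [ea <-]]] := occ_lit_split e.
have et : toks phi = map snd u ++ Lit l.1 :: Dummy ::
    (map Dig (binary l.2) ++ Dummy :: map snd v).
  by rewrite /toks ea map_cat /= map_cat map_cat -map_comp -catA.
have nthE d : nth Dummy (toks phi) (size u + d) = nth Dummy (Lit l.1 :: Dummy ::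
    (map Dig (binary l.2) ++ Dummy :: map snd v)) d.
  by rewrite et nth_cat size_map ltnNge leq_addr addKn.
split.
- by rewrite -addn1 nthE.
- move=> d hd; rewrite -addnA nthE add2n /= nth_cat size_map hd.
  by rewrite (nth_map false).
- by rewrite -addnA nthE add2n /= nth_cat size_map ltnn subnn.
- have -> : size (annotate phi) = size (toks phi) by rewrite size_map.
  rewrite et !size_cat /= !size_map size_cat /= !size_map.
  by rewrite -addnA ltn_add2l add2n !ltnS addnS ltnS leq_addr.
Qed.

Lemma occ_clause_end phi p j k l : occ phi p = occ_lit j k l ->
  occ phi (clause_end phi p) = occ_cls j (size (nth [::] phi j)).
Proof.
move=> e; have [hj _ _] := occ_lit_dom e; have [c ec] := occ_cls_exists hj.
by rewrite /clause_end e /occ nth_index // (occ_mem ec).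
Qed.

Lemma occ_lt phi p q x y : occ phi p = Some x -> occ phi q = Some y ->
  ~~ precedes (Some y) (Some x) -> x <> y -> p < q.
Proof.
move=> ep eq np ne; case: (ltngtP p q) => // [lt|e].
  by have := @occ_precedes phi q p; rewrite lt (occ_size ep) ep eq (negbTE np) => /(_ isT).
by case: ne; move: ep; rewrite e eq => -[].
Qed.

Lemma lt_clause_end phi p j k l : occ phi p = occ_lit j k l -> p < clause_end phi p.
Proof.
move=> e; apply: (occ_lt e (occ_clause_end e)) => //.
by rewrite /= ltnn.
Qed.

(** A clause end strictly between the literal and the end of its clause j would belong to a clause
    j' with j <= j' < j. *)
Lemma toks_clause_layout phi :
  clause_layout (size (annotate phi)) (toks phi) (clause_end phi).
Proof.
move=> p b /lit_sign_tok [j [k [l [e _]]]]; have ec := occ_clause_end e.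
have hc : clause_end phi p < size (annotate phi).
  by have := occ_size ec; rewrite size_map.
split=> //; first exact: lt_clause_end e.
  by rewrite -/(tok_at phi _) (tok_at_cls ec).
move=> q /andP[pq qc]; apply/negP => /is_cls_tok [j' [n' eq]].
have := @occ_precedes phi p q; rewrite pq (occ_size eq) e eq => /(_ isT) /= h1.
have := @occ_precedes phi q (clause_end phi p).
by rewrite qc (occ_size ec) ec eq => /(_ isT) /=; lia.
Qed.

(* The prescribed frequency, in sixths, of a pair of positions p < q that
   stand for x and y; None if the pair is not in the family. *)
Definition pair_weight (x y : occurrence) : option nat :=
  match x, y with
  | Some (inl (j, _, l)), Some (inl (j', _, l')) =>
      if (j == j') || (l.1 != l'.1) && (l.2 == l'.2) then Some 0 else None
  | Some (inl (j, _, _)), Some (inr (j', _)) => if j == j' then Some 1 else None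
  | _, _ => None
  end.

Lemma binary_eq m n : (binary m == binary n) = (m == n).
Proof. by apply/eqP/eqP => [/binary_inj|->]. Qed.

(** Since [occs] is ordered, comparing [q] with the clause end of [p] amounts to comparing clause
    numbers, and equal digits mean equal variables. *)
Lemma pair_valueE phi p q j k l : occ phi p = occ_lit j k l -> p < q ->
  pair_value (toks phi) (digits_at phi) (clause_end phi) p q =
  pair_weight (occ phi p) (occ phi q).
Proof.
move=> e pq; rewrite /pair_value /conflict -!/(tok_at phi _) (tok_at_lit e).
have ec := occ_clause_end e; have pc := lt_clause_end e.
rewrite /digits_at e; have := tok_at_matches phi q.
rewrite /token_matches [_.1]/= [_.2]/=.
case eq : (occ phi q) => [[[[j' k'] l']|[j' n']]|] /=.
- move=> /eqP ->; rewrite /= binary_eq.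
  have := @occ_precedes phi p q; rewrite pq (occ_size eq) e eq => /(_ isT) /= h1.
  case: (ltngtP q (clause_end phi p)) => [lt|gt|ee].
  + have := @occ_precedes phi q (clause_end phi p).
    rewrite lt (occ_size ec) ec eq => /(_ isT) /= h2.
    by have -> : j == j' by lia.
  + have := @occ_precedes phi (clause_end phi p) q.
    rewrite gt (occ_size eq) ec eq => /(_ isT) /= h2.
    by have -> : (j == j') = false by lia.
  + by move: eq; rewrite ee ec.
- move=> /eqP ->.
  have := @occ_precedes phi p q; rewrite pq (occ_size eq) e eq => /(_ isT) /= h1.
  case: (ltngtP q (clause_end phi p)) => [lt|gt|ee] /=.
  + have := @occ_precedes phi q (clause_end phi p).
    rewrite lt (occ_size ec) ec eq => /(_ isT) /= h2.
    by have -> : (j == j') = false by lia.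
  + have := @occ_precedes phi (clause_end phi p) q.
    rewrite gt (occ_size eq) ec eq => /(_ isT) /= h2.
    by have -> : (j == j') = false by lia.
  + by move: eq; rewrite ee ec => -[->]; rewrite eqxx.
- move=> /andP[/eqP -> _].
  by case: (ltngtP q (clause_end phi p)) => // ee; move: eq; rewrite ee ec.
Qed.

(** * The family in terms of clauses and literals *)

Definition family_items (phi : cnf) : seq item :=
  ([::], 6) :: flatten [seq position_items (size (annotate phi)) (toks phi)
    (digits_at phi) (clause_end phi) p | p <- iota 0 (size (annotate phi))].

Lemma mem_pairs phi p m it j k l : occ phi p = occ_lit j k l ->
  reflect (exists q v, [/\ p < q < p.+1 + m, pair_weight (occ phi p) (occ phi q) = Some v
                          & it = ([:: q; p], v)])
    (it \in pairs (toks phi) (digits_at phi) (clause_end phi) p m).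
Proof.
move=> e; rewrite /pairs mem_pmap.
apply: (iffP mapP) => [[q]|[q [v [h1 h2 ->]]]].
  rewrite mem_iota => hq; rewrite (pair_valueE e); last by lia.
  by case ev : (pair_weight _ _) => [v|] //= [->]; exists q, v.
exists q; first by rewrite mem_iota.
by rewrite (pair_valueE e) ?h2 //; lia.
Qed.

(** This description separates the combinatorics from the machine. The bound on clause sizes ensures
    that the token of a clause carries its true length. *)
Lemma family_itemsP phi it (K := size (annotate phi)) :
  (forall C, C \in phi -> size C <= 3) ->
  it \in family_items phi <->
  [\/ it = ([::], 6),
      exists p j k l, occ phi p = occ_lit j k l /\ it = ([:: p], 1),
      exists p j n, occ phi p = occ_cls j n /\ it = ([:: p], n) |
      exists p q v, [/\ p < q, q < K, pair_weight (occ phi p) (occ phi q) = Some v &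
                      it = ([:: q; p], v)]].
Proof.
move=> h3; rewrite inE; split.
  move=> /orP[/eqP->|]; first by constructor 1.
  move=> /flattenP[s /mapP[p]]; rewrite mem_iota /= => hp ->.
  rewrite /position_items -/(tok_at phi p).
  have := tok_at_matches phi p; rewrite /token_matches [_.1]/= [_.2]/=.
  case e : (occ phi p) => [[[[j k] l]|[j n]]|] /=.
  - move=> /eqP ->; rewrite inE => /orP[/eqP->|].
      by constructor 2; exists p, j, k, l.
    move=> /(mem_pairs _ _ e) [q [v [h1 h2 ->]]]; constructor 4; exists p, q, v.
    by move: h1; rewrite subnKC // => /andP[].
  - move=> /eqP ->; rewrite inE => /eqP ->; constructor 3; exists p, j, n.
    split=> //; rewrite inordK //; have [hj ->] := occ_cls_dom e.
    by rewrite ltnS; apply: h3; apply: mem_nth.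
  - by case: (tok_at phi p) => [[b|b]|[n|]] /andP[].
have inK p x : occ phi p = Some x -> p \in iota 0 K.
  by move=> /occ_size; rewrite size_map mem_iota.
move=> hit; apply/orP; case: hit =>
  [->|[p [j [k [l [e ->]]]]]|[p [j [n [e ->]]]]|[p [q [v [pq hq w ->]]]]].
- by left.
- right; apply/flattenP; eexists; first by apply: map_f (inK _ _ e).
  by rewrite /position_items -/(tok_at phi p) (tok_at_lit e) inE eqxx.
- right; apply/flattenP; eexists; first by apply: map_f (inK _ _ e).
  rewrite /position_items -/(tok_at phi p) (tok_at_cls e) inE inordK //.
  by have [hj ->] := occ_cls_dom e; rewrite ltnS; apply: h3; apply: mem_nth.
- have [x [e [j [k [l ex]]]]] : exists x, occ phi p = Some x /\ exists j k l, x = inl (j, k, l).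
    by case: (occ phi p) w => [[[[j k] l]|[j n]]|] //= _; eexists; split => //; exists j, k, l.
  rewrite ex in e; right; apply/flattenP; eexists; first by apply: map_f (inK _ _ e).
  rewrite /position_items -/(tok_at phi p) (tok_at_lit e) inE; apply/orP; right.
  by apply/(mem_pairs _ _ e); exists q, v; split=> //;
  rewrite subnKC ?pq //; apply: leq_trans pq (ltnW hq).
Qed.

(** An item ends with the position under which it is listed, so items of different positions differ;
    those of one position differ in their other entry. *)
Lemma uniq_family_items phi : uniq (map fst (family_items phi)).
Proof.
set K := size (annotate phi).
have last_p p s : s \in map fst (position_items K (toks phi) (digits_at phi)
    (clause_end phi) p) -> last 0 s = p /\ s <> [::].
  rewrite /position_items; case: (nth _ _ _) => [[b|b]|[n|]] //=; last first.
    by rewrite inE => /eqP ->.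
  rewrite inE => /orP[/eqP -> //|/mapP[it]].
  rewrite /pairs mem_pmap => /mapP[q _]; case: (pair_value _ _ _ _ _) => //= v [->] ->.
  by [].
rewrite /family_items -/K map_cons map_flatten -map_comp cons_uniq.
apply/andP; split.
  by apply/negP => /flattenP[s /mapP[p _ ->]] /last_p [].
elim: (iota 0 K) (iota_uniq 0 K) => // p s IH /andP[hp us].
rewrite map_cons flatten_cons.
rewrite cat_uniq IH // andbT; apply/andP; split.
  rewrite [(_ \o _) p]/= /position_items; case: (nth _ _ p) => [[b|b]|[n|]] //=.
  apply/andP; split.
    apply/negP => /mapP[it]; rewrite /pairs mem_pmap => /mapP[q _].
    by case: (pair_value _ _ _ _ _) => //= v [->].
  (* The listed pairs are a selection from all pairs with smaller position [p]. *)
  apply: (@subseq_uniq _ _ [seq [:: q; p] | q <- iota p.+1 (K - p.+1)]); last first.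
    by rewrite map_inj_uniq ?iota_uniq // => q q' [].
  rewrite /pairs; elim: (iota p.+1 _) => //= q r IHr.
  case: (pair_value _ _ _ _ _) => [v|] /=; first by rewrite eqxx.
  by move: (subseq_trans IHr (subseq_cons _ [:: q; p])); case: (map fst _).
apply/hasPn => x /flattenP[t /mapP[q hq ->]] /last_p [lq _].
by apply/negP => /last_p [lp _]; move: hp; rewrite -lp lq hq.
Qed.

(** * The reduction and its running time *)

Definition positions (phi : cnf) : nat := size (annotate phi).

Definition item_set K (it : item) : {set 'I_K} := [set i : 'I_K | val i \in it.1].

Definition reduction (phi : cnf) : mq_data :=
  @MQData (positions phi) (size (family_items phi))
    (map_tuple (item_set (positions phi)) (in_tuple (family_items phi)))
    (map_tuple (fun it => theta_of it.2) (in_tuple (family_items phi)))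
    [set i : 'I_(positions phi) | is_cls (tok_at phi i)] (theta_of 0).

Lemma enc_set_pred K (P : pred nat) :
  enc_set [set i : 'I_K | P i] = enc_seq enc_bool [seq P i | i <- iota 0 K].
Proof.
rewrite /enc_set -val_enum_ord -map_comp; congr enc_seq.
by apply: eq_map => i; rewrite inE.
Qed.

Lemma encode_reduction phi : (forall C, C \in phi -> size C <= 3) ->
  enc_mq (reduction phi) =
  output_word (enc_cnf phi) (digits_at phi) (clause_end phi).
Proof.
move=> h3; have eK := size_annotate h3; have et := tokenize_annotate h3.
rewrite /output_word /items -eK et -/(toks phi) -/(family_items phi).
rewrite -[enc_mq _]/(enc_nat (positions phi) ++
  enc_seq (@enc_set _) (map (item_set (positions phi)) (family_items phi)) ++
  enc_seq enc_rat (map (fun it => theta_of it.2) (family_items phi)) ++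
  enc_set [set i : 'I_(positions phi) | is_cls (tok_at phi i)] ++
  enc_rat (theta_of 0)).
rewrite /family_word /theta_word -/(positions phi).
have -> : enc_set [set i : 'I_(positions phi) | is_cls (tok_at phi i)] =
    enc_seq enc_bool [seq is_cls (tok_at phi i) | i <- iota 0 (positions phi)].
  exact: (enc_set_pred _ (fun i => is_cls (tok_at phi i))).
rewrite enc_bitsE /enc_seq -!map_comp.
have -> : [seq (@enc_set (positions phi) \o item_set (positions phi)) i
   | i <- family_items phi] = [seq mark_word (positions phi) it.1 | it <- family_items phi].
  by apply: eq_map => it; rewrite /= /item_set (enc_set_pred _ (fun i => i \in it.1)).
have assoc (a f1 f2 q r : word) :
    a ++ (Open :: f1 ++ [:: Close]) ++ (Open :: f2 ++ [:: Close]) ++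
      (Open :: q ++ [:: Close]) ++ r =
    (((((a ++ Open :: f1) ++ [:: Close]) ++ ((Open :: f2) ++ [:: Close])) ++
      [:: Open]) ++ q) ++ Close :: r.
  by rewrite !(cat_cons, =^~ catA).
exact: assoc.
Qed.

(** * Polynomial running time *)

Lemma size_flatten_map (T : eqType) (T' : Type) (f : T -> seq T') c (s : seq T) :
  (forall x, x \in s -> size (f x) <= c) -> size (flatten (map f s)) <= c * size s.
Proof.
elim: s => //= x s IH h; rewrite size_cat mulnS leq_add ?h ?inE ?eqxx //.
by apply: IH => y hy; apply: h; rewrite inE hy orbT.
Qed.

Lemma size_pairs ts bits cl p m : size (pairs ts bits cl p m) <= m.
Proof. by rewrite size_pmap -[X in _ <= X](size_iota p.+1 m) count_size. Qed.

Lemma size_family_items phi (K := positions phi) :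
  size (family_items phi) <= 1 + (K + 1) * K.
Proof.
rewrite /= ltnS -/(positions phi) -/K.
have := @size_flatten_map _ _ (position_items K (toks phi) (digits_at phi) (clause_end phi))
  (K + 1) (iota 0 K); rewrite size_iota; apply=> p _.
rewrite /position_items; case: (nth _ _ _) => [[b|b]|[n|]] //=; try by lia.
by have := size_pairs (toks phi) (digits_at phi) (clause_end phi) p (K - p.+1); lia.
Qed.

Lemma family_items_lt7 phi it : (forall C, C \in phi -> size C <= 3) ->
  it \in family_items phi -> it.2 < 7.
Proof.
move=> h3 /(family_itemsP _ h3)[->|[p [j [k [l [_ ->]]]]]|[p [j [n [e ->]]]]|] //.
  have [hj ->] := occ_cls_dom e; rewrite /=.
  by apply: (@leq_ltn_trans 3) => //; apply: h3; apply: mem_nth.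
move=> [p [q [v [_ _ + ->]]]] /=.
by case: (occ phi p) (occ phi q) => [[[[j k] l]|[j n]]|] [[[[j' k'] l']|[j' n']]|] //=;
  case: ifP => // _ [<-].
Qed.

Lemma theta_cost_le n : n < 7 -> size (enc_rat (theta_of n)) <= theta_cost.
Proof.
move=> hn.
exact: (@leq_bigmax _ (fun n : 'I_7 => size (enc_rat (theta_of n))) (Ordinal hn)).
Qed.

(** The empty itemset, and at most [K + 1] items per position. *)
Definition items_bound K := 1 + (K + 1) * K.
Definition theta_bound K := 1 + theta_cost * items_bound K.
(** The term [K + 2] bounds the code of K, by [size_binary], as well as each characteristic vector
    with its two brackets. *)
Definition output_bound K :=
  (K + 2) + (1 + (K + 2) * items_bound K) + theta_bound K + K + theta_cost + 5.
Definition time_bound K := 4 * (theta_bound K + 1) + 2 * output_bound K +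
  K * (pairs_cost K + emit_cost K + 20) + K * (4 * K + 10) + 20 * K +
  2 * theta_cost + 60.

Lemma program_cost_le phi : (forall C, C \in phi -> size C <= 3) ->
  program_cost (enc_cnf phi) (digits_at phi) (clause_end phi) <=
  time_bound (size (enc_cnf phi)).
Proof.
move=> h3; have eK := size_annotate h3; have et := tokenize_annotate h3.
set K := size (enc_cnf phi).
have ei : items (enc_cnf phi) (digits_at phi) (clause_end phi) = family_items phi.
  by rewrite /items -eK et.
have hN : size (family_items phi) <= items_bound K.
  by rewrite /K -eK; exact: size_family_items.
have hT : size (theta_word (family_items phi)) <= theta_bound K.
  suff h : size (flatten [seq enc_rat (theta_of it.2) | it <- family_items phi]) <=
    theta_cost * items_bound K by exact: h.
  apply: (@leq_trans (theta_cost * size (family_items phi))).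
    apply: size_flatten_map => it hit.
    by apply: theta_cost_le; apply: family_items_lt7 hit.
  by rewrite leq_mul2l hN orbT.
have hF : size (family_word K (enc_nat K) (family_items phi)) <=
    (K + 2) + (1 + (K + 2) * items_bound K).
  rewrite /family_word size_cat leq_add //.
    rewrite /enc_nat enc_bitsE /= size_cat size_map /=.
    by have := size_binary K; lia.
  suff h : size (flatten [seq mark_word K it.1 | it <- family_items phi]) <=
    (K + 2) * items_bound K by exact: h.
  apply: (@leq_trans ((K + 2) * size (family_items phi))).
    apply: size_flatten_map => it _; rewrite /mark_word enc_bitsE.
    by rewrite /= size_cat !size_map size_iota addn1 addn2.
  by rewrite leq_mul2l hN orbT.
have hO : size (output_word (enc_cnf phi) (digits_at phi) (clause_end phi)) <=
    output_bound K.
  have sz (a b q r : word) :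
      size (((((a ++ [:: Close]) ++ (b ++ [:: Close])) ++ [:: Open]) ++ q) ++ Close :: r) =
      size a + size b + size q + size r + 4.
    by rewrite !size_cat /=; lia.
  rewrite /output_word ei -/K sz !size_map size_iota.
  have := @theta_cost_le 0 isT; rewrite /output_bound; move: hF hT.
  by move: (size (family_word _ _ _)) (size (theta_word _)) (size (enc_rat _)) => a b c; lia.
rewrite /program_cost ei /time_bound -/K; move: hT hO.
by move: (size (theta_word _)) (size (output_word _ _ _)) => a b; lia.
Qed.

(** Allows [time_bound] to remain an arithmetic expression: closure under sums and products provides
    the polynomial. *)
Definition polynomial_fun (f : nat -> nat) : Prop :=
  exists p : {poly nat}, forall n, p.[n]%R = f n.

Lemma polynomial_const c : polynomial_fun (fun=> c).
Proof. by exists (c%:P)%R => n; exact: hornerC. Qed.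

Lemma polynomial_id : polynomial_fun id.
Proof. by exists 'X%R => n; exact: hornerX. Qed.

Lemma polynomial_add f g :
  polynomial_fun f -> polynomial_fun g -> polynomial_fun (fun n => f n + g n).
Proof.
by move=> [p hp] [q hq]; exists (p + q)%R => n; rewrite hornerD hp hq.
Qed.

Lemma polynomial_mul f g :
  polynomial_fun f -> polynomial_fun g -> polynomial_fun (fun n => f n * g n).
Proof.
by move=> [p hp] [q hq]; exists (p * q)%R => n; rewrite hornerM hp hq.
Qed.

Lemma polynomial_time_bound : polynomial_fun time_bound.
Proof.
rewrite /time_bound /output_bound /theta_bound /items_bound /pairs_cost /emit_cost.
by repeat first [exact: polynomial_const | exact: polynomial_id
  | apply: polynomial_add | apply: polynomial_mul].
Qed.

Lemma leading_written w : leading_word (map Some (map (@inl _ aux) w)) = w.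
Proof. by elim: w => //= s w ->. Qed.

Lemma reduction_polynomial_time (R : realType) :
  polynomial_time (P := threeSAT) (Q := MaxQueryDec R) reduction.
Proof.
have [p hp] := polynomial_time_bound.
exists (machine_of program), p => phi h3.
have eK := size_annotate h3; have et := tokenize_annotate h3.
have [||T [hT eO]] := @exec_program (enc_cnf phi) (digits_at phi) (clause_end phi).
- by rewrite -eK et; exact: toks_literal_layout.
- by rewrite -eK et; exact: toks_clause_layout.
have := @exec_computes 4 aux program (enc_cnf phi) T _
  (exec_leq _ (exec_same _ hT)).
rewrite (_ : ord_max = iO) ?eO; last exact: val_inj.
have -> (L : seq (symbol + aux)) : from_head (at_pos 0 L) = map Some L.
  by rewrite /at_pos drop0.
rewrite leading_written => h.
rewrite /= encode_reduction // hp; apply: h; first exact: program_cost_le.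
by case=> [[|[|[|[|[|k]]]]] hi] //; rewrite !ffunE.
Qed.

(** * Frequencies *)

Section Family.

Variables (R : realType) (phi : cnf).
Hypothesis size3 : forall C, C \in phi -> size C <= 3.

Local Notation K := (positions phi).
Local Notation its := (family_items phi).
Local Notation Omega := (Omega K).
Local Notation literal_of j k := (nth literal0 (nth [::] phi j) k).

Lemma occ_ord p x : occ phi p = Some x -> exists i : 'I_K, val i = p.
Proof. by move=> /occ_size; rewrite size_map => h; exists (Ordinal h). Qed.

Lemma forall_item (w : Omega) it :
  reflect (forall i : 'I_K, val i \in it.1 -> w i) [forall i in item_set K it, w i].
Proof.
apply: (iffP forall_inP) => h i; last by rewrite inE; exact: h.
by move=> hi; apply: h; rewrite inE.
Qed.

Lemma item_cls p j n : occ phi p = occ_cls j n -> ([:: p], n) \in its.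
Proof. by move=> e; apply/family_itemsP => //; constructor 3; exists p, j, n. Qed.

Lemma item_pair p q v : p < q -> pair_weight (occ phi p) (occ phi q) = Some v ->
  ([:: q; p], v) \in its.
Proof.
move=> pq h; apply/family_itemsP => //; constructor 4; exists p, q, v; split=> //.
case e : (occ phi q) h => [x|] h; first by rewrite -(size_map fst); exact: occ_size e.
by case: (occ phi p) h => [[[[]]|[]]|].
Qed.

Lemma item_single p x : occ phi p = Some x -> exists v, ([:: p], v) \in its.
Proof.
case: x => [[[j k] l]|[j n]] e; last by exists n; exact: item_cls e.
by exists 1; apply/family_itemsP => //; constructor 2; exists p, j, k, l.
Qed.

Lemma pair_weight_Some x y v : pair_weight x y = Some v ->
  exists x' y', x = Some x' /\ y = Some y'.
Proof. by case: x y => [x|] [y|] //; [exists x, y | case: x => [[[]]|[]]]. Qed.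

Lemma item_sorted it : it \in its -> sorted gtn it.1 /\ all (gtn K) it.1.
Proof.
move=> /(family_itemsP _ size3)
  [->|[p [j [k [l [/occ_size e ->]]]]]|[p [j [n [/occ_size e ->]]]]|] //=.
- by rewrite /gtn andbT; move: e; rewrite size_map.
- by rewrite /gtn andbT; move: e; rewrite size_map.
- by move=> [p [q [v [pq hq _ ->]]]] /=; rewrite /gtn /= pq hq (ltn_trans pq hq).
Qed.

(** Items are strictly decreasing lists, and such a list is determined by its set of entries. *)
Lemma uniq_family : uniq (map (item_set K) its).
Proof.
have -> : map (item_set K) its =
    map (fun ps => [set i : 'I_K | val i \in ps]) (map fst its) by rewrite -map_comp.
rewrite map_inj_in_uniq; first exact: uniq_family_items.
move=> _ _ /mapP[it1 h1 ->] /mapP[it2 h2 ->] /setP e.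
have [s1 /allP b1] := item_sorted h1; have [s2 /allP b2] := item_sorted h2.
apply: (irr_sorted_eq (leT := gtn)) => // [x y z|x|x].
- by rewrite /gtn /= => h h'; apply: ltn_trans h' h.
- by rewrite /gtn /= ltnn.
apply/idP/idP => hx.
  by have := e (Ordinal (b1 _ hx)); rewrite !inE /= hx => <-.
by have := e (Ordinal (b2 _ hx)); rewrite !inE /= hx => ->.
Qed.

(** Antimonotonicity on the level of lists: both positions of a listed pair stand for an occurrence,
    and every occurrence has its singleton in the family. *)
Lemma item_filter it (P : pred nat) : it \in its -> exists v, (filter P it.1, v) \in its.
Proof.
have i0 : ([::], 6) \in its by rewrite inE eqxx.
move=> /(family_itemsP _ size3)
  [->|[p [j [k [l [e ->]]]]]|[p [j [n [e ->]]]]|[p [q [v [pq hq hw ->]]]]] /=.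
- by exists 6.
- by case: (P p); [exact: item_single e | exists 6].
- by case: (P p); [exact: item_single e | exists 6].
- have [x [y [ex ey]]] := pair_weight_Some hw.
  case: (P q); case: (P p); [|exact: item_single ey|exact: item_single ex|by exists 6].
  by exists v; exact: item_pair.
Qed.

Lemma antimonotonic_family : antimonotonic (map (item_set K) its).
Proof.
move=> X Y /mapP[it hit ->] sub.
have [v hv] := item_filter [pred p | [exists i in Y, val i == p]] hit.
apply/mapP; eexists; first exact: hv.
apply/setP => i; rewrite inE /= mem_filter.
apply/idP/andP => [hi|[/exists_inP[i' hi' /eqP/val_inj <-]] //].
split; first by apply/exists_inP; exists i.
by have := subsetP sub i hi; rewrite inE.
Qed.

(* Every literal occurrence is on in exactly one of the six worlds
   [(b, s)]: b is its truth value under the assignment a, and s its rank in the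
   clause, after exchanging the rank [chosen j] with 0. *)
Section Worlds.

Variables (a : nat -> bool) (chosen : nat -> 'I_3).

Definition world_of j k (l : literal) : bool * 'I_3 :=
  (a l.2 == l.1, tperm (chosen j) ord0 (inord k)).

Definition on (g : bool * 'I_3) (x : occurrence) : bool :=
  match x with
  | Some (inl (j, k, l)) => world_of j k l == g
  | Some (inr (j, n)) =>
      [exists k : 'I_3, (k < n) && (world_of j k (literal_of j k) == g)]
  | None => false
  end.

Definition world (g : bool * 'I_3) : Omega := [ffun i : 'I_K => on g (occ phi i)].

(** A sum over [g], since several [g] may give the same point of [Omega]. *)
Definition mixture : {ffun Omega -> R} :=
  [ffun w => \sum_(g | world g == w) (6%:R^-1)]%R.

Lemma frequency_mixture B : frequency mixture B =
  (#|[set g | [forall i in B, world g i]]|%:R / 6%:R)%R.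
Proof.
rewrite /frequency; under eq_bigr do rewrite ffunE.
rewrite (exchange_big_dep (fun g => [forall i in B, world g i])) /=.
  under eq_bigr => g hg.
    rewrite (bigD1 (world g)) /= ?hg ?eqxx // big1 ?addr0; last first.
      by move=> w /andP[/andP[_ /eqP ->]]; rewrite eqxx.
    over.
  by rewrite sumr_const cardsE mulr_natl.
by move=> w g hw /eqP ->.
Qed.

Lemma is_distribution_mixture : is_distribution mixture.
Proof.
split=> [w|]; first by rewrite ffunE sumr_ge0 // => g _; rewrite invr_ge0 ler0n.
have := frequency_mixture set0; rewrite /frequency.
rewrite (eq_bigl xpredT) => [->|w]; last by apply/forall_inP => i; rewrite inE.
rewrite (_ : [set g | _] = setT); last first.
  by apply/setP => g; rewrite !inE; apply/forall_inP => i; rewrite inE.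
by rewrite cardsT card_prod card_bool card_ord divff // pnatr_eq0.
Qed.

Lemma world_item g it : it \in its ->
  [forall i in item_set K it, world g i] = all (fun p => on g (occ phi p)) it.1.
Proof.
move=> /item_sorted [_ /allP b]; apply/forall_item/allP => h.
  by move=> p hp; have := h (Ordinal (b _ hp)) hp; rewrite ffunE.
by move=> i hi; rewrite ffunE; exact: h.
Qed.

Lemma world_of_inj j (k k' : 'I_3) l l' :
  world_of j k l = world_of j k' l' -> k = k'.
Proof. by move=> [_ /perm_inj]; rewrite !inord_val. Qed.

Lemma lit_dom3 p j k l : occ phi p = occ_lit j k l ->
  k < 3 /\ l = literal_of j k.
Proof.
move=> /occ_lit_dom [hj hk ->]; split=> //.
by apply: leq_trans hk _; apply: size3; apply: mem_nth.
Qed.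

(** The frequencies in sixths count worlds, whatever [a] and [chosen] are: a literal is on in one
    world; a clause of n literals in n, since distinct ranks give distinct worlds; a clause with one
    of its literals in the world of that literal; an excluded pair in none. *)
Lemma card_item it : it \in its ->
  #|[set g | all (fun p => on g (occ phi p)) it.1]| = it.2.
Proof.
move=> /(family_itemsP _ size3)
  [->|[p [j [k [l [e ->]]]]]|[p [j [n [e ->]]]]|[p [q [v [pq hq hw ->]]]]].
- rewrite (_ : [set g | _] = setT); last by apply/setP => g; rewrite !inE.
  by rewrite cardsT card_prod card_bool card_ord.
- rewrite (_ : [set g | _] = [set world_of j k l]) ?cards1 //.
  by apply/setP => g; rewrite !inE /= e andbT eq_sym.
- have [hj en] := occ_cls_dom e.
  have n3 : n <= 3 by rewrite en; apply: size3; apply: mem_nth.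
  rewrite (_ : [set g | _] = (fun k : 'I_3 => world_of j k (literal_of j k)) @:
      [set k : 'I_3 | k < n]).
    rewrite card_imset; last by move=> k k' /world_of_inj.
    rewrite cardsE /= cardE -(size_map val) /enum_mem -enumT.
    rewrite -(filter_map val (gtn n)) val_enum_ord -[in RHS](size_iota 0 n).
    by case: n n3 {e en} => [|[|[|[|//]]]].
  apply/setP => g; rewrite !inE /= e andbT.
  apply/existsP/imsetP => [[k /andP[kn /eqP <-]]|[k]].
    by exists k; rewrite ?inE.
  by rewrite inE => kn ->; exists k; rewrite kn eqxx.
(* Complementary literals differ in the truth component of their worlds. *)
- have cl0 l l' : l.1 != l'.1 -> l.2 = l'.2 -> (a l.2 == l.1) != (a l'.2 == l'.1).
    by move=> h ->; case: (a _) (l.1) (l'.1) h => [] [] [].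
  case ep : (occ phi p) hw => [[[[j k] l]|[j n]]|] //=;
  case eq : (occ phi q) => [[[[j' k'] l']|[j' n']]|] //=; case: ifP => // h [<-].
    apply/eqP; rewrite cards_eq0; apply/eqP/setP => g; rewrite !inE /= ?ep ?eq /= andbT.
    apply/negP => /andP[/eqP <-] /eqP [e1 e2].
    have [k3 el] := lit_dom3 ep; have [k3' el'] := lit_dom3 eq.
    move: h => /orP[/eqP jj|/andP[h1 /eqP h2]]; last first.
      by have := cl0 _ _ h1 h2; rewrite e1 eqxx.
    (* In one clause, equal worlds mean equal ranks; then both positions carry the same occurrence,
       against [p < q]. *)
    have kk : k = k'.
      by move: e2; rewrite jj => /perm_inj /(congr1 (@nat_of_ord 3)); rewrite !inordK.
    by have := occ_inj ep (p := p) (q := q); rewrite eq jj kk el el' jj kk => /(_ erefl); lia.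
  rewrite (_ : [set g | _] = [set world_of j k l]) ?cards1 //.
  apply/setP => g; rewrite !inE /= ?ep ?eq /= andbT eq_sym andbC.
  case: eqP => //= ->; apply/existsP; have [k3 el] := lit_dom3 ep.
  have jj := eqP h; exists (inord k); rewrite -jj inordK // el eqxx andbT.
  have [_ hk _] := occ_lit_dom ep; have [_ ->] := occ_cls_dom eq.
  by rewrite -jj.
Qed.

Lemma mixture_satisfies :
  satisfies_freq (mq_family (reduction phi)) (mq_theta (reduction phi)) mixture.
Proof.
split; first exact: is_distribution_mixture.
move=> i; rewrite !tnth_map; set it := tnth _ i.
have hit : it \in its by exact: mem_tnth.
rewrite frequency_mixture; under eq_finset do rewrite world_item //.
by rewrite card_item // /theta_of fmorph_div /= !ratr_nat.
Qed.

End Worlds.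

End Family.

(** * Correctness of the reduction *)

Section Correctness.

Variables (R : realType) (phi : cnf).
Hypothesis size3 : forall C, C \in phi -> size C <= 3.

Local Notation K := (positions phi).
Local Notation its := (family_items phi).
Local Notation Omega := (Omega K).
Local Notation literal_of j k := (nth literal0 (nth [::] phi j) k).

Lemma reduction_instance : @instance (MaxQueryDec R) (reduction phi).
Proof.
split=> //.
- exact: uniq_family.
- exact: antimonotonic_family.
(* Any assignment and any choice of ranks would serve as witness, so consistency holds for
   unsatisfiable formulas too. *)
- by exists (mixture R phi xpredT (fun=> ord0)); exact: mixture_satisfies.
Qed.

Lemma ratr_threshold : ratr (mq_threshold (reduction phi)) = 0%R :> R.
Proof. by rewrite /= /theta_of mul0r rmorph0. Qed.

Lemma satisfiable_yes a :
  satisfies_cnf a phi -> @yes (MaxQueryDec R) (reduction phi).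
Proof.
move=> /allP sat.
(* The index of the first true literal; it is below 3 in every satisfied clause. *)
pose chosen j : 'I_3 := inord (find (fun l : literal => a l.2 == l.1) (nth [::] phi j)).
exists (mixture R phi a chosen); split; first exact: mixture_satisfies.
rewrite ratr_threshold frequency_mixture divr_gt0 ?ltr0n // card_gt0.
apply/set0Pn; exists (true, ord0); rewrite inE; apply/forall_inP => i.
rewrite inE ffunE => /is_cls_tok [j [n e]]; rewrite e /=.
have [hj en] := occ_cls_dom e.
have hC : nth [::] phi j \in phi by apply: mem_nth.
have := sat _ hC; rewrite has_find => hf.
have f3 : find (fun l : literal => a l.2 == l.1) (nth [::] phi j) < 3.
  by apply: leq_trans hf (size3 hC).
have pv : chosen j = find (fun l : literal => a l.2 == l.1) (nth [::] phi j) :> nat.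
  by rewrite inordK.
apply/existsP; exists (chosen j); rewrite /world_of inord_val tpermL pv en hf /=.
by have /(nth_find literal0) /eqP -> := sat _ hC; rewrite eqxx.
Qed.

Section Extract.

Variable q : {ffun Omega -> R}.
Hypothesis hq : satisfies_freq (mq_family (reduction phi)) (mq_theta (reduction phi)) q.

Lemma q_ge0 w : (0 <= q w)%R.
Proof. by case: hq => -[]. Qed.

Lemma frequency_item it : it \in its ->
  frequency q (item_set K it) = (it.2%:R / 6%:R)%R.
Proof.
move=> /(nthP it) [i hi e]; have [_ /(_ (Ordinal hi))] := hq.
rewrite !tnth_map (tnth_nth it) /= e => ->.
by rewrite /theta_of fmorph_div /= !ratr_nat.
Qed.

Lemma zero_item w it : it \in its -> it.2 = 0 -> (0 < q w)%R ->
  [forall i in item_set K it, w i] = false.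
Proof.
move=> hit e0 hw; apply/negP => h; have := frequency_item hit.
rewrite e0 mul0r => /psumr_eq0P => /(_ (fun w _ => q_ge0 w)) /(_ _ h) e.
by rewrite e ltxx in hw.
Qed.

(** The family lists a pair only with the smaller position first; assuming the weight in both orders
    makes the situation symmetric. *)
Lemma exclusive w (i i' : 'I_K) : (0 < q w)%R -> val i != val i' ->
  pair_weight (occ phi i) (occ phi i') = Some 0 ->
  pair_weight (occ phi i') (occ phi i) = Some 0 -> ~~ (w i && w i').
Proof.
move=> hw; wlog lt : i i' / i < i'.
  move=> h ne h1 h2; have [lt|lt|e] := ltngtP i i'; first exact: h.
    by rewrite andbC; apply: h; rewrite // eq_sym.
  by rewrite /= e eqxx in ne.
move=> _ h _; apply/negP => /andP[wi wi'].
have := zero_item (item_pair size3 lt h) erefl hw.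
move=> /negP; apply; apply/forall_item => i'' /=.
by rewrite !inE => /orP[] /eqP /val_inj ->.
Qed.

Lemma clause_literal w (c : 'I_K) j n : (0 < q w)%R -> w c ->
  occ phi c = occ_cls j n ->
  exists (k : nat) (i : 'I_K), [/\ occ phi i = occ_lit j k (literal_of j k), k < n & w i].
Proof.
move=> hw wc ec; have [hj en] := occ_cls_dom ec.
have /fin_all_exists [P hP] (k : 'I_n) :
    exists i : 'I_K, occ phi i = occ_lit j k (literal_of j k).
  have [|p ep] := @occ_lit_exists phi j k hj; first by rewrite -en.
  by have [i ei] := occ_ord ep; exists i; rewrite ei.
case: (boolP [exists k, w (P k)]) => [/existsP[k hk]|hn].
  by exists k, (P k).
pose ind (b : bool) : R := (b%:R)%R.
(* If no literal of the clause is on in [w], the defect at [w] is 1; the aim is to show that it is 0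
   wherever [q] is positive. *)
pose defect (v : Omega) : R := (ind (v c) - \sum_(k < n) ind (v c && v (P k)))%R.
have freqE (B : {set 'I_K}) (f : Omega -> bool) :
    (forall v : Omega, [forall i in B, v i] = f v) ->
    frequency q B = (\sum_(v : Omega) q v * ind (f v))%R.
  move=> h; rewrite /frequency big_mkcond; apply: eq_bigr => v _; rewrite h /ind.
  by case: (f v); rewrite ?mulr1 ?mulr0.
have fc : (\sum_(v : Omega) q v * ind (v c) = n%:R / 6%:R)%R.
  rewrite -(frequency_item (item_cls size3 ec)); apply/esym/freqE => v.
  apply/forall_item/idP => [h|h i]; first by apply: h; rewrite inE.
  by rewrite inE => /eqP /val_inj ->.
have fp k : (\sum_(v : Omega) q v * ind (v c && v (P k)) = 1 / 6%:R)%R.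
  have lt : P k < c by apply: (occ_lt (hP k) ec) => //=; rewrite ltnn.
  have hit : ([:: val c; val (P k)], 1) \in its.
    by apply: item_pair => //; rewrite (hP k) ec /= eqxx.
  rewrite -(frequency_item hit); apply/esym/freqE => v.
  apply/forall_item/andP => [h|[h1 h2] i].
    by split; apply: h; rewrite !inE eqxx ?orbT.
  by rewrite !inE => /orP[] /eqP /val_inj ->.
(* The mean is n/6 minus n times 1/6. *)
have total : (\sum_v q v * defect v = 0)%R.
  under eq_bigr do rewrite mulrBr mulr_sumr.
  rewrite sumrB fc exchange_big /= (eq_bigr (fun=> (1 / 6%:R)%R)); last by move=> k _; exact: fp.
  by rewrite sumr_const card_ord mul1r -[X in (_ - X)%R]mulr_natl subrr.
(* At a point of positive mass two literals of the clause are never on together, so the sum in the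
   defect is at most 1. *)
have defect_ge0 v : (0 <= q v * defect v)%R.
  have [->|hv] := eqVneq (q v) 0%R; first by rewrite mul0r.
  have {}hv : (0 < q v)%R by rewrite lt0r hv q_ge0.
  rewrite mulr_ge0 ?q_ge0 // subr_ge0 /ind.
  case vc : (v c) => /=; last by rewrite big1.
  rewrite -natr_sum ler_nat -big_mkcond /= sum1_card.
  apply/card_le1_eqP => k k'; rewrite !unfold_in => hk hk'.
  apply: contraTeq hk => ne; apply/negP => hk.
  have hw1 : pair_weight (occ phi (P k)) (occ phi (P k')) = Some 0 by rewrite !hP /= eqxx.
  have hw2 : pair_weight (occ phi (P k')) (occ phi (P k)) = Some 0 by rewrite !hP /= eqxx.
  have nP : val (P k) != val (P k').
    apply: contra ne => /eqP e; have := hP k; rewrite e hP => -[e' _].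
    by apply/eqP/val_inj.
  by have := exclusive hv nP hw1 hw2; rewrite hk hk'.
have : (q w * defect w = 0)%R by exact: (psumr_eq0P (fun v _ => defect_ge0 v) total).
rewrite /defect wc /ind big1 => [|k _]; first by rewrite subr0 mulr1 => e; rewrite e ltxx in hw.
by rewrite /=; case wk : (w (P k)) => //; case/negP: hn; apply/existsP; exists k.
Qed.

Lemma yes_satisfiable : (0 < frequency q (mq_query (reduction phi)))%R ->
  exists a, satisfies_cnf a phi.
Proof.
move=> hB.
have [w hw wB] : exists2 w, (0 < q w)%R & [forall i in mq_query (reduction phi), w i].
  case: (boolP [exists w, (0 < q w)%R && [forall i in mq_query (reduction phi), w i]]).
    by move=> /existsP[w /andP[]]; exists w.
  move=> /existsPn h; move: hB; rewrite /frequency big1 ?ltxx // => w hw.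
  by have := h w; rewrite hw andbT lt0r q_ge0 andbT negbK => /eqP.
pose pos v i := if occ phi i is Some (inl (_, _, l)) then l.1 && (l.2 == v) else false.
(* A variable is true when a positive occurrence of it is on in [w]. A negative literal that is on
   in [w] is then true as well, because it excludes all positive occurrences of its variable. *)
exists (fun v => [exists i : 'I_K, w i && pos v (val i)]).
apply/allP => C hC; set a := (X in has X).
pose j := index C phi.
have hj : j < size phi by rewrite index_mem.
have eC : nth [::] phi j = C by rewrite nth_index.
have [p ep] := occ_cls_exists hj; have [c ec] := occ_ord ep; rewrite -ec in ep.
have wc : w c by apply: (forall_inP wB); rewrite inE (tok_at_cls ep).
have [k [i [ei hk wi]]] := clause_literal hw wc ep.
rewrite eC in ei hk; set l := nth literal0 C k in ei.
apply/hasP; exists l; first exact: mem_nth.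
rewrite /a; case el : l.1.
  rewrite eqb_id; apply/existsP; exists i.
  by rewrite wi /pos ei /= el eqxx.
rewrite eqbF_neg; apply/existsPn => i'; apply/negP => /andP[wi'].
rewrite /pos; case ei' : (occ phi (val i')) => [[[[j' k'] l']|]|] // /andP[l1 /eqP l2].
have hw1 : pair_weight (occ phi i) (occ phi i') = Some 0.
  by rewrite ei ei' -/l /= el l1 l2 eqxx orbT.
have hw2 : pair_weight (occ phi i') (occ phi i) = Some 0.
  by rewrite ei ei' -/l /= el l1 l2 eqxx orbT.
have ne : val i != val i'.
  apply/eqP => e; move: ei'; rewrite -e ei => -[_ _ ell].
  by move: l1; rewrite -ell -/l el.
by have := exclusive hw ne hw1 hw2; rewrite wi wi'.
Qed.

End Extract.

End Correctness.

Theorem theorem3 (R : realType) : polytime_reducible threeSAT (MaxQueryDec R).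
Proof.
exists reduction; split; first exact: reduction_polynomial_time.
move=> phi h3; split; first exact: reduction_instance.
split=> [[a ha]|[q [hq]]]; first exact: satisfiable_yes ha.
by rewrite ratr_threshold; exact: yes_satisfiable.
Qed.
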